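(* 1) An element $f\in\mathcal{H}^\infty$ is invertible in the algebra $\mathcal{H}^\infty$ if and only if it is bounded below on $\mathbb{C}_0$, i.e. if and only if there exists $\delta>0$ such that $|f(s)|\ge\delta$ for all $s\in\mathbb{C}_0$. 2) There exist $f_1,f_2\in\mathcal{H}^\infty$ and $\delta>0$ such that $|f_1(s)|+|f_2(s)|\ge\delta$ for every $s\in\mathbb{C}_0$, and yet $f_1g_1+f_2g_2\neq 1$ for every pair of functions $g_1,g_2\in\mathcal{H}^\infty$.
   Context: $\mathbb{C}_0=\{s\in\mathbb{C}:\operatorname{Re}s>0\}$. $\mathcal{H}^\infty$ denotes the set of Dirichlet series $f(s)=\sum_{n=1}^\infty a_nn^{-s}$ (with complex coefficients, convergent in some half-plane) which are analytic and bounded in $\mathbb{C}_0$, i.e. whose sum has a bounded analytic extension to $\mathbb{C}_0$, still denoted $f$. Equipped with pointwise operations and the norm $\|f\|_\infty=\sup_{s\in\mathbb{C}_0}|f(s)|$, it is a unital commutative Banach algebra. *)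

(* Defs.v *)
From Stdlib Require Import Reals.
From Coquelicot Require Export Coquelicot.

Local Open Scope R_scope.

(** The open right half-plane. *)
Definition C0 (s : C) : Prop := 0 < Re s.

Definition Cexp (z : C) : C :=
  (exp (Re z) * cos (Im z), exp (Re z) * sin (Im z)).

(** [n^(-s)] for a positive integer [n]. *)
Definition npow_opp (n : nat) (s : C) : C :=
  Cexp (Cmult (Copp s) (RtoC (ln (INR n)))).

(** The sum over [n >= 1] of [a n * n^(-s)] converges to [l]; Coquelicot's
    series start at index 0, hence the shift. *)
Definition is_dirichlet_series (a : nat -> C) (s l : C) : Prop :=
  is_series (K := C_AbsRing) (V := C_NormedModule)
    (fun k => Cmult (a (S k)) (npow_opp (S k) s)) l.

Definition holomorphic_on_C0 (f : C -> C) : Prop :=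
  forall s : C, C0 s -> ex_derive (K := C_AbsRing) (V := C_NormedModule) f s.

Definition bounded_on_C0 (f : C -> C) : Prop :=
  exists M : R, forall s : C, C0 s -> Cmod (f s) <= M.

(** An element of the algebra is represented by a total function [f : C -> C]
    whose values outside [C0] are irrelevant: on [C0] it is the bounded analytic
    extension of the sum of a Dirichlet series.  Requiring [0 <= sigma] loses
    nothing, since a half-plane of convergence can always be shrunk, and keeps
    the values of [f] outside [C0] unconstrained. *)
Definition Hinf (f : C -> C) : Prop :=
  (exists (a : nat -> C) (sigma : R), 0 <= sigma /\
     forall s : C, sigma < Re s -> is_dirichlet_series a s (f s))
  /\ holomorphic_on_C0 f
  /\ bounded_on_C0 f.

(** Invertibility for the pointwise product; equality of elements is equality
    on [C0]. *)
Definition Hinf_invertible (f : C -> C) : Prop :=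
  exists g : C -> C, Hinf g /\
    forall s : C, C0 s -> Cmult (f s) (g s) = RtoC 1.

Definition bounded_below_on_C0 (f : C -> C) : Prop :=
  exists delta : R, 0 < delta /\
    forall s : C, C0 s -> delta <= Cmod (f s).

(* Main.v *)
(** Part 1.  If [|f| >= delta] on [C0], letting [Re s] tend to infinity gives
    [|a_1| >= delta], so the coefficient sequence has an inverse [b] for Dirichlet
    convolution.  Far to the right the tail of [sum |a_n| n^(-s)] is small against
    [|a_1|], which bounds the partial sums of [sum |b_n| n^(-s)] by absorption; the
    product of the two absolutely convergent series is then [1].

    Part 2.  Take [f1 = 2^(-s)] and [f2 = 3^(-s) - 1/9].  They are never both
    small on [C0], since [3^(-s)] is small wherever [2^(-s)] is; but with
    [z1 = 2^(-s)] and [z2 = 3^(-s)] treated as independent variables they share the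
    zero [(0, 1/9)].  Concretely, in [f1 g1 + f2 g2 = 1] the term [f1 g1] has no
    coefficient at [3^k], so the coefficients of [g2] satisfy [b_(3^k) = - 9^(k+1)].
    On the other hand [b_(3^k)] is the mean value of [3^(ks) g2(s)] along a vertical
    line on which the series converges absolutely, and Cauchy's theorem shifts this
    line to [Re s = 1], so [|b_(3^k)| <= M 3^k]: a contradiction. *)

Require Import Defs.
From Stdlib Require Import Reals Lra Lia Arith.
From Coquelicot Require Import Coquelicot.

Local Open Scope R_scope.

(** * Complex derivatives *)

(** In Part 1 the reciprocal of [f] is bounded and holomorphic on [C0] at once; the work lies in
    showing that it is the sum of a Dirichlet series somewhere. This requires absolute convergence,
    while membership in the algebra only gives convergence: moving two units to the right turns
    bounded terms into terms of order 1/n^2. In Part 2 the obstacle is that the series of [g2] may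
    converge only far to the right. On a line Re s = x there, the mean value bounds the coefficient
    at 3^k by a multiple of 3^(kx) with x out of control, which does not contradict growth like 9^k.
    The constant 1/9 = 3^(-2) puts the zeros of 3^(-s) - 1/9 on Re s = 2. The coefficients therefore
    grow like 3^(2k), and any line with 0 < Re s < 2 yields the contradiction. *)

Definition Cderiv (f : C -> C) (z l : C) : Prop :=
  is_derive (K := C_AbsRing) (V := C_NormedModule) f z l.

Lemma Cderiv_eps (f : C -> C) (z l : C) :
  Cderiv f z l <->
  forall eps, 0 < eps -> exists d, 0 < d /\ forall w, Cmod (w - z) < d ->
    Cmod (f w - f z - (w - z) * l) <= eps * Cmod (w - z).
Proof.
  split.
  - intros [_ H] eps Heps.
    assert (L : is_filter_lim (T := AbsRing_UniformSpace C_AbsRing)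
                  (@locally (AbsRing_UniformSpace C_AbsRing) z) z)
      by (intros P HP; exact HP).
    destruct (H z L (mkposreal eps Heps)) as [d Hd].
    exists d; split; [apply cond_pos|].
    intros w Hw; exact (Hd w Hw).
  - intros H; split.
    + apply (is_linear_scal_l (K := C_AbsRing) (V := C_NormedModule)).
    + intros x Hx.
      apply (is_filter_lim_locally_unique
               (V := AbsRing_NormedModule C_AbsRing)) in Hx.
      subst x. intros eps.
      destruct (H eps (cond_pos eps)) as [d [Hd HH]].
      exists (mkposreal d Hd). intros w Hw. exact (HH w Hw).
Qed.

Lemma Cderiv_ext (f g : C -> C) (z l l' : C) :
  (forall w, f w = g w) -> l = l' -> Cderiv f z l -> Cderiv g z l'.
Proof.
  intros H <-. apply is_derive_ext. exact H.
Qed.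

(** Bridges the two normed-module structures on [C]: the product rule, and the inner function of the
    chain rule, live on [AbsRing_NormedModule C_AbsRing]. *)
Lemma Cderiv_AbsRing (f : C -> C) (z l : C) :
  Cderiv f z l <->
  is_derive (K := C_AbsRing) (V := AbsRing_NormedModule C_AbsRing) f z l.
Proof.
  split; intros [_ H]; (split; [apply is_linear_scal_l | exact H]).
Qed.

Lemma Cderiv_const (c z : C) : Cderiv (fun _ => c) z (RtoC 0).
Proof. apply (is_derive_const (K := C_AbsRing) (V := C_NormedModule)). Qed.

Lemma Cderiv_id (z : C) : Cderiv (fun w => w) z (RtoC 1).
Proof.
  apply Cderiv_eps. intros eps Heps. exists 1; split; [lra|].
  intros w _. replace (w - z - (w - z) * RtoC 1)%C with (RtoC 0) by ring.
  rewrite Cmod_0. apply Rmult_le_pos; [lra|apply Cmod_ge_0].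
Qed.

Lemma Cderiv_plus (f g : C -> C) (z l m : C) :
  Cderiv f z l -> Cderiv g z m -> Cderiv (fun w => f w + g w)%C z (l + m)%C.
Proof. apply (is_derive_plus (K := C_AbsRing) (V := C_NormedModule)). Qed.

Lemma Cderiv_comp (f g : C -> C) (z l m : C) :
  Cderiv f (g z) l -> Cderiv g z m -> Cderiv (fun w => f (g w)) z (m * l)%C.
Proof.
  intros Hf Hg. apply Cderiv_AbsRing in Hg.
  apply (is_derive_comp (K := C_AbsRing) (V := C_NormedModule) f g z l m Hf Hg).
Qed.

Lemma Cderiv_mult (f g : C -> C) (z l m : C) :
  Cderiv f z l -> Cderiv g z m ->
  Cderiv (fun w => f w * g w)%C z (l * g z + f z * m)%C.
Proof.
  intros Hf%Cderiv_AbsRing Hg%Cderiv_AbsRing. apply Cderiv_AbsRing.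
  apply (is_derive_mult (K := C_AbsRing) f g z l m Hf Hg). exact Cmult_comm.
Qed.

Lemma Cderiv_continuous (f : C -> C) (z l : C) :
  Cderiv f z l ->
  forall eps, 0 < eps -> exists d, 0 < d /\ forall w, Cmod (w - z) < d ->
    Cmod (f w - f z) <= eps.
Proof.
  intros H eps Heps. apply Cderiv_eps with (eps := 1) in H; [|lra].
  destruct H as [d [Hd H]].
  assert (Hl := Cmod_ge_0 l).
  exists (Rmin d (eps / (1 + Cmod l))). split.
  { apply Rmin_pos; [lra|]. apply Rdiv_lt_0_compat; lra. }
  intros w Hw.
  assert (Hw1 := Rlt_le_trans _ _ _ Hw (Rmin_l _ _)).
  assert (Hw2 := Rlt_le_trans _ _ _ Hw (Rmin_r _ _)).
  specialize (H w Hw1).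
  replace (f w - f z)%C with ((f w - f z - (w - z) * l) + (w - z) * l)%C by ring.
  eapply Rle_trans; [apply Cmod_triangle|]. rewrite Cmod_mult.
  apply Rmult_lt_compat_r with (r := 1 + Cmod l) in Hw2; [|lra].
  replace (eps / (1 + Cmod l) * (1 + Cmod l)) with eps in Hw2 by (field; lra).
  nra.
Qed.

Lemma Cderiv_inv (z : C) : z <> RtoC 0 -> Cderiv Cinv z (- / (z * z))%C.
Proof.
  intros Hz. apply Cderiv_eps. intros eps Heps.
  assert (Hm : 0 < Cmod z) by (apply Cmod_gt_0; exact Hz).
  (* The remainder is (w - z)^2 / (w z^2). The first radius keeps |w| above |z| / 2, and the second
     then makes |w - z| / (|w| |z|^2) at most [eps]. *)
  exists (Rmin (Cmod z / 2) (eps * Cmod z ^ 3 / 2)). split.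
  { assert (0 < Cmod z ^ 3) by (apply pow_lt; lra). apply Rmin_pos; nra. }
  intros w Hw.
  assert (Hw1 := Rlt_le_trans _ _ _ Hw (Rmin_l _ _)).
  assert (Hw2 := Rlt_le_trans _ _ _ Hw (Rmin_r _ _)).
  assert (Hwz : Cmod z <= Cmod w + Cmod (w - z)).
  { replace z with (w + - (w - z))%C at 1 by ring.
    eapply Rle_trans; [apply Cmod_triangle|]. rewrite Cmod_opp. lra. }
  assert (Hw0 : w <> RtoC 0) by (apply Cmod_gt_0; lra).
  replace (/ w - / z - (w - z) * - / (z * z))%C
    with ((w - z) * ((w - z) * / (w * (z * z))))%C by (field; auto).
  assert (Hn : (w * (z * z))%C <> RtoC 0) by (repeat apply Cmult_neq_0; auto).
  rewrite Cmod_mult, (Cmod_mult (w - z) (/ _)), Cmod_inv, !Cmod_mult by exact Hn.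
  rewrite Rmult_comm. apply Rmult_le_compat_r; [apply Cmod_ge_0|].
  assert (H3 : 0 < Cmod w * (Cmod z * Cmod z)) by (repeat apply Rmult_lt_0_compat; lra).
  apply Rmult_le_reg_r with (1 := H3).
  rewrite Rmult_assoc, Rinv_l, Rmult_1_r by lra.
  apply Rlt_le, Rlt_le_trans with (1 := Hw2).
  assert (H4 : eps * (Cmod z * Cmod z) * (Cmod z / 2) <= eps * (Cmod z * Cmod z) * Cmod w).
  { apply Rmult_le_compat_l; [|lra]. repeat apply Rmult_le_pos; lra. }
  lra.
Qed.

(** * The complex exponential and its derivative *)

Lemma Cmod_Cexp (z : C) : Cmod (Cexp z) = exp (Re z).
Proof.
  unfold Cmod, Cexp; simpl fst; simpl snd.
  replace (_ ^ 2 + _ ^ 2) with ((exp (Re z))²).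
  - apply sqrt_Rsqr, Rlt_le, exp_pos.
  - assert (H := sin2_cos2 (Im z)). unfold Rsqr in *.
    transitivity (exp (Re z) * exp (Re z) *
      (sin (Im z) * sin (Im z) + cos (Im z) * cos (Im z))); [rewrite H|]; ring.
Qed.

Lemma Cexp_plus (z w : C) : Cexp (z + w) = (Cexp z * Cexp w)%C.
Proof.
  unfold Cexp, Cmult; simpl. rewrite exp_plus, cos_plus, sin_plus.
  apply injective_projections; simpl; unfold Re, Im; ring.
Qed.

Lemma Cexp_0 : Cexp 0 = RtoC 1.
Proof.
  unfold Cexp; simpl. rewrite exp_0, cos_0, sin_0.
  apply injective_projections; simpl; ring.
Qed.

Lemma Cmod_le_Rabs (z : C) : Cmod z <= Rabs (fst z) + Rabs (snd z).
Proof.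
  replace z with ((fst z, 0) + (0, snd z))%C at 1.
  - eapply Rle_trans; [apply Cmod_triangle|]. unfold Cmod; simpl.
    rewrite !Rmult_0_l, !Rmult_1_r, Rplus_0_r, Rplus_0_l.
    fold (Rsqr (fst z)). fold (Rsqr (snd z)). rewrite !sqrt_Rsqr_abs. lra.
  - destruct z; unfold Cplus; simpl. f_equal; ring.
Qed.

(* From [1 + y <= exp y] at [y = x] and [y = - x]. *)
Lemma exp_taylor1 (x : R) : Rabs x <= 1 / 2 -> Rabs (exp x - 1 - x) <= 2 * x ^ 2.
Proof.
  intros Hx. apply Rabs_le_between in Hx.
  assert (H1 := exp_ineq1_le x). assert (H2 := exp_ineq1_le (- x)).
  assert (H3 : exp x * exp (- x) = 1)
    by (rewrite <- exp_plus, Rplus_opp_r; apply exp_0).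
  assert (H4 := exp_pos x).
  apply Rabs_le_between. split; [nra|].
  assert (exp x * (1 - x) <= 1) by nra. nra.
Qed.

Lemma sin_le_abs (y : R) : Rabs (sin y) <= Rabs y.
Proof.
  destruct (MVT_abs sin cos 0 y) as [c [H _]].
  { intros; apply derivable_pt_lim_sin. }
  rewrite sin_0, !Rminus_0_r in H. rewrite H.
  rewrite <- (Rmult_1_l (Rabs y)) at 2. apply Rmult_le_compat_r; [apply Rabs_pos|].
  apply Rabs_le, COS_bound.
Qed.

Lemma cos_taylor1 (y : R) : Rabs (cos y - 1) <= y ^ 2.
Proof.
  destruct (MVT_abs cos (fun t => - sin t) 0 y) as [c [H Hc]].
  { intros; apply derivable_pt_lim_cos. }
  rewrite cos_0, Rminus_0_r, Rabs_Ropp in H. rewrite H, <- Rsqr_pow2, Rsqr_abs.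
  apply Rmult_le_compat_r; [apply Rabs_pos|].
  eapply Rle_trans; [apply sin_le_abs|].
  revert Hc; unfold Rmin, Rmax; destruct (Rle_dec 0 y); unfold Rabs;
  destruct (Rcase_abs c), (Rcase_abs y); lra.
Qed.

Lemma sin_taylor1 (y : R) : Rabs y <= 1 -> Rabs (sin y - y) <= y ^ 2.
Proof.
  intros Hy.
  destruct (MVT_abs (fun t => sin t - t) (fun t => cos t - 1) 0 y) as [c [H Hc]].
  { intros. apply (derivable_pt_lim_minus sin (fun t => t)).
    - apply derivable_pt_lim_sin.
    - apply derivable_pt_lim_id. }
  rewrite sin_0, !Rminus_0_r in H. rewrite H, <- (Rsqr_pow2 y), Rsqr_abs.
  apply Rmult_le_compat_r; [apply Rabs_pos|].
  assert (Hcy : Rabs c <= Rabs y).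
  { revert Hc; unfold Rmin, Rmax; destruct (Rle_dec 0 y); unfold Rabs;
    destruct (Rcase_abs c), (Rcase_abs y); lra. }
  eapply Rle_trans; [apply cos_taylor1|].
  rewrite <- Rsqr_pow2, Rsqr_abs. unfold Rsqr.
  assert (H0 := Rabs_pos c). nra.
Qed.

(** Real and imaginary parts are split so that each piece contains one of the three real Taylor
    remainders or the product x sin y. The pieces add up to at most 7 |h|^2; 8 is a convenient
    bound. *)
Lemma Cexp_taylor1 (h : C) :
  Cmod h <= 1 / 2 -> Cmod (Cexp h - 1 - h) <= 8 * Cmod h ^ 2.
Proof.
  intros Hh. assert (H := Rmax_Cmod h).
  assert (Hx := Rle_trans _ _ _ (Rmax_l _ _) H).
  assert (Hy := Rle_trans _ _ _ (Rmax_r _ _) H).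
  clear H. destruct h as [x y]. simpl fst in *; simpl snd in *.
  set (m := Cmod (x, y)) in *.
  assert (Hxm : x ^ 2 <= m ^ 2)
    by (rewrite <- !Rsqr_pow2, (Rsqr_abs x); apply Rsqr_incr_1;
        auto using Rabs_pos; apply Cmod_ge_0).
  assert (Hym : y ^ 2 <= m ^ 2)
    by (rewrite <- !Rsqr_pow2, (Rsqr_abs y); apply Rsqr_incr_1;
        auto using Rabs_pos; apply Cmod_ge_0).
  assert (He := exp_taylor1 x ltac:(lra)).
  assert (Hc := cos_taylor1 y).
  assert (Hs := sin_taylor1 y ltac:(lra)).
  assert (Hs' := sin_le_abs y).
  assert (Hx2 := proj1 (Rabs_le_between _ _) (Rle_trans _ _ _ Hx Hh)).
  eapply Rle_trans; [apply Cmod_le_Rabs|]. unfold Cexp; simpl.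
  replace (exp x * cos y + - (1) + - x)
    with ((exp x - 1 - x) * cos y + (1 + x) * (cos y - 1)) by ring.
  replace (exp x * sin y + - 0 + - y)
    with ((exp x - 1 - x) * sin y + (x * sin y) + (sin y - y)) by ring.
  fold (x ^ 2) in *.
  assert (B1 : Rabs ((exp x - 1 - x) * cos y) <= 2 * x ^ 2).
  { rewrite Rabs_mult. assert (Rabs (cos y) <= 1) by (apply Rabs_le, COS_bound).
    assert (A := Rabs_pos (exp x - 1 - x)). nra. }
  assert (B2 : Rabs ((exp x - 1 - x) * sin y) <= x ^ 2).
  { rewrite Rabs_mult. assert (A := Rabs_pos (exp x - 1 - x)).
    assert (A' := Rabs_pos (sin y)). nra. }
  assert (B3 : Rabs ((1 + x) * (cos y - 1)) <= 2 * y ^ 2).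
  { rewrite Rabs_mult, (Rabs_pos_eq (1 + x)) by lra. nra. }
  assert (B4 : Rabs (x * sin y) <= m ^ 2).
  { rewrite Rabs_mult. assert (A := Rabs_pos x). assert (A' := Rabs_pos (sin y)).
    nra. }
  replace (m * (m * 1)) with (m ^ 2) by ring.
  assert (T1 := Rabs_triang ((exp x - 1 - x) * cos y) ((1 + x) * (cos y - 1))).
  assert (T2 := Rabs_triang ((exp x - 1 - x) * sin y + x * sin y) (sin y - y)).
  assert (T3 := Rabs_triang ((exp x - 1 - x) * sin y) (x * sin y)).
  assert (T4 := pow2_ge_0 m). lra.
Qed.

(** The functional equation transports the estimate at 0 to the point z, at the cost of the factor
    |Cexp z| = exp (Re z). *)
Lemma Cderiv_Cexp (z : C) : Cderiv Cexp z (Cexp z).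
Proof.
  apply Cderiv_eps. intros eps Heps.
  assert (He := exp_pos (Re z)).
  assert (Hk : 0 < 8 * exp (Re z)) by lra.
  exists (Rmin (1 / 2) (eps / (8 * exp (Re z)))). split.
  { apply Rmin_pos; [lra|]. apply Rdiv_lt_0_compat; lra. }
  intros w Hw.
  assert (Hw1 := Rlt_le_trans _ _ _ Hw (Rmin_l _ _)).
  assert (Hw2 := Rlt_le_trans _ _ _ Hw (Rmin_r _ _)).
  replace w with (z + (w - z))%C at 1 by ring. rewrite Cexp_plus.
  replace (Cexp z * Cexp (w - z) - Cexp z - (w - z) * Cexp z)%C
    with (Cexp z * (Cexp (w - z) - 1 - (w - z)))%C by ring.
  rewrite Cmod_mult, Cmod_Cexp.
  assert (H := Cexp_taylor1 (w - z) ltac:(lra)).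
  apply Rmult_lt_compat_r with (1 := Hk) in Hw2.
  replace (eps / (8 * exp (Re z)) * (8 * exp (Re z))) with eps in Hw2 by (field; lra).
  assert (H0 := Cmod_ge_0 (w - z)).
  apply Rle_trans with (exp (Re z) * (8 * Cmod (w - z) ^ 2)); [nra|].
  simpl. nra.
Qed.

Lemma Cderiv_scal (c z : C) : Cderiv (fun w => c * w)%C z c.
Proof.
  assert (H := Cderiv_mult _ _ _ _ _ (Cderiv_const c z) (Cderiv_id z)).
  cbv beta in H. replace (RtoC 0 * z + c * RtoC 1)%C with c in H by ring. exact H.
Qed.

Lemma Cderiv_Cexp_scal (c z : C) : Cderiv (fun w => Cexp (c * w)) z (c * Cexp (c * z)).
Proof. apply (Cderiv_comp Cexp), Cderiv_scal. apply Cderiv_Cexp. Qed.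

(** * Cauchy's theorem for rectangles *)

Notation CInt := (@RInt C_R_CompleteNormedModule).
Notation ex_CInt := (@ex_RInt C_R_CompleteNormedModule).
Notation is_CInt := (@is_RInt C_R_CompleteNormedModule).

Lemma CInt_correct (u : R -> C) (a b : R) : ex_CInt u a b -> is_CInt u a b (CInt u a b).
Proof. apply (RInt_correct (V := C_R_CompleteNormedModule)). Qed.

Lemma is_CInt_plus (u v : R -> C) (a b : R) (k l : C) :
  is_CInt u a b k -> is_CInt v a b l -> is_CInt (fun t => u t + v t)%C a b (k + l)%C.
Proof. apply (is_RInt_plus (V := C_R_CompleteNormedModule)). Qed.

Lemma is_CInt_minus (u v : R -> C) (a b : R) (k l : C) :
  is_CInt u a b k -> is_CInt v a b l -> is_CInt (fun t => u t - v t)%C a b (k - l)%C.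
Proof. apply (is_RInt_minus (V := C_R_CompleteNormedModule)). Qed.

Lemma is_CInt_const (k : C) (a b : R) :
  is_CInt (fun _ => k) a b (RtoC (b - a) * k)%C.
Proof.
  replace (RtoC (b - a) * k)%C with (@scal R_AbsRing C_R_CompleteNormedModule (b - a) k).
  - apply (is_RInt_const (V := C_R_CompleteNormedModule)).
  - destruct k as [x y]. unfold scal, RtoC, Cmult; simpl.
    unfold prod_scal, scal; simpl. unfold mult; simpl.
    f_equal; ring.
Qed.

(** The comparison is with an arbitrary constant [k], not only 0, so that the affine part of an
    integrand can be subtracted in Goursat's estimate. *)
Lemma CInt_norm_le (u : R -> C) (a b M : R) (k l : C) :
  a <= b -> (forall t, a <= t <= b -> Cmod (u t - k) <= M) ->
  is_CInt u a b l -> Cmod (l - RtoC (b - a) * k) <= (b - a) * M.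
Proof.
  intros Hab HM Hl. rewrite Cmod_norm.
  apply (norm_RInt_le_const (V := C_R_CompleteNormedModule) (fun t => u t - k)%C);
    [exact Hab| |].
  - intros t Ht. specialize (HM t Ht). rewrite Cmod_norm in HM. exact HM.
  - apply is_CInt_minus; [exact Hl|apply is_CInt_const].
Qed.

Lemma CInt_norm_le0 (u : R -> C) (a b M : R) (l : C) :
  a <= b -> (forall t, a <= t <= b -> Cmod (u t) <= M) ->
  is_CInt u a b l -> Cmod l <= (b - a) * M.
Proof.
  intros Hab HM Hl. replace l with (l - RtoC (b - a) * 0)%C by ring.
  apply (CInt_norm_le u); [exact Hab| |exact Hl].
  intros t Ht. replace (u t - 0)%C with (u t) by ring. auto.
Qed.

Lemma CInt_Chasles (u : R -> C) (a b c : R) :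
  ex_CInt u a b -> ex_CInt u b c -> (CInt u a b + CInt u b c)%C = CInt u a c.
Proof. apply (RInt_Chasles (V := C_R_CompleteNormedModule)). Qed.

Definition holo_at (f : C -> C) (z : C) : Prop := exists l, Cderiv f z l.

Lemma continuous_eps (u : R -> C) (t : R) :
  (forall eps, 0 < eps -> exists d, 0 < d /\
     forall s, Rabs (s - t) < d -> Cmod (u s - u t) <= eps) ->
  continuous (U := C_R_CompleteNormedModule) u t.
Proof.
  intros H.
  apply (filterlim_locally (U := C_R_CompleteNormedModule)). intros eps.
  destruct (H (eps / 2)) as [d [Hd HH]]. { assert (He := cond_pos eps); lra. }
  exists (mkposreal d Hd). intros s Hs.
  apply C_NormedModule_mixin_compat1.
  apply Rle_lt_trans with (eps / 2); [exact (HH s Hs)|].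
  assert (He := cond_pos eps); lra.
Qed.

Lemma continuous_h (f : C -> C) (x y : R) :
  holo_at f (x, y) ->
  continuous (U := C_R_CompleteNormedModule) (fun t => f (t, y)) x.
Proof.
  intros [l Hl]. apply continuous_eps. intros eps Heps.
  destruct (Cderiv_continuous f _ l Hl eps Heps) as [d [Hd H]].
  exists d; split; [exact Hd|]. intros s Hs. apply H.
  eapply Rle_lt_trans; [apply Cmod_le_Rabs|]. simpl.
  rewrite Rplus_opp_r, Rabs_R0. unfold Rminus in Hs. lra.
Qed.

Lemma continuous_v (f : C -> C) (x y : R) :
  holo_at f (x, y) ->
  continuous (U := C_R_CompleteNormedModule) (fun t => f (x, t)) y.
Proof.
  intros [l Hl]. apply continuous_eps. intros eps Heps.
  destruct (Cderiv_continuous f _ l Hl eps Heps) as [d [Hd H]].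
  exists d; split; [exact Hd|]. intros s Hs. apply H.
  eapply Rle_lt_trans; [apply Cmod_le_Rabs|]. simpl.
  rewrite Rplus_opp_r, Rabs_R0. unfold Rminus in Hs. lra.
Qed.

Definition holo_rect (f : C -> C) (a b c d : R) : Prop :=
  forall x y, a <= x <= b -> c <= y <= d -> holo_at f (x, y).

Lemma ex_CInt_h (f : C -> C) (a b y : R) :
  a <= b -> (forall x, a <= x <= b -> holo_at f (x, y)) ->
  ex_CInt (fun t => f (t, y)) a b.
Proof.
  intros Hab H. apply (ex_RInt_continuous (V := C_R_CompleteNormedModule)).
  rewrite Rmin_left, Rmax_right by exact Hab. intros z Hz. apply continuous_h; auto.
Qed.

Lemma ex_CInt_v (f : C -> C) (x c d : R) :
  c <= d -> (forall y, c <= y <= d -> holo_at f (x, y)) ->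
  ex_CInt (fun t => f (x, t)) c d.
Proof.
  intros Hab H. apply (ex_RInt_continuous (V := C_R_CompleteNormedModule)).
  rewrite Rmin_left, Rmax_right by exact Hab. intros z Hz. apply continuous_v; auto.
Qed.

(** The contour integral of f(z) dz counterclockwise around [a, b] x [c, d]: bottom minus top, plus
    i times right minus left, since dz = i dt on vertical sides. *)
Definition rect_int (f : C -> C) (a b c d : R) : C :=
  ((CInt (fun t => f (t, c)) a b - CInt (fun t => f (t, d)) a b) +
   Ci * (CInt (fun t => f (b, t)) c d - CInt (fun t => f (a, t)) c d))%C.

Lemma rect_int_split_x (f : C -> C) (a m b c d : R) :
  a <= m <= b -> c <= d -> holo_rect f a b c d ->
  rect_int f a b c d = (rect_int f a m c d + rect_int f m b c d)%C.
Proof.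
  intros Hm Hcd H. unfold rect_int.
  rewrite <- (CInt_Chasles (fun t => f (t, c)) a m b),
          <- (CInt_Chasles (fun t => f (t, d)) a m b).
  - ring.
  - apply ex_CInt_h; [|intros; apply H]; lra.
  - apply ex_CInt_h; [|intros; apply H]; lra.
  - apply ex_CInt_h; [|intros; apply H]; lra.
  - apply ex_CInt_h; [|intros; apply H]; lra.
Qed.

Lemma rect_int_split_y (f : C -> C) (a b c m d : R) :
  a <= b -> c <= m <= d -> holo_rect f a b c d ->
  rect_int f a b c d = (rect_int f a b c m + rect_int f a b m d)%C.
Proof.
  intros Hab Hm H. unfold rect_int.
  rewrite <- (CInt_Chasles (fun t => f (a, t)) c m d),
          <- (CInt_Chasles (fun t => f (b, t)) c m d).
  - ring.
  - apply ex_CInt_v; [|intros; apply H]; lra.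
  - apply ex_CInt_v; [|intros; apply H]; lra.
  - apply ex_CInt_v; [|intros; apply H]; lra.
  - apply ex_CInt_v; [|intros; apply H]; lra.
Qed.

(* The boundary integral of the affine function [f z0 + (z - z0) * l] vanishes,
   so only the remainder contributes. *)
Lemma rect_int_small (f : C -> C) (a b c d eps : R) (z0 l : C) :
  a <= b -> c <= d -> 0 <= eps -> holo_rect f a b c d ->
  a <= fst z0 <= b -> c <= snd z0 <= d ->
  (forall x y, a <= x <= b -> c <= y <= d ->
     Cmod (f (x, y) - f z0 - ((x, y) - z0) * l) <= eps * Cmod ((x, y) - z0)%C) ->
  Cmod (rect_int f a b c d) <= 2 * eps * ((b - a) + (d - c)) ^ 2.
Proof.
  intros Hab Hcd Heps H Hx0 Hy0 HH.
  set (D := (b - a) + (d - c)).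
  assert (HR : forall x y, a <= x <= b -> c <= y <= d ->
     Cmod (f (x, y) - f z0 - ((x, y) - z0) * l) <= eps * D).
  { intros x y Hx Hy. eapply Rle_trans; [apply HH; auto|].
    apply Rmult_le_compat_l; [exact Heps|].
    eapply Rle_trans; [apply Cmod_le_Rabs|]. simpl.
    apply Rplus_le_compat; apply Rabs_le; destruct z0; simpl in *; lra. }
  assert (E1 : forall y, c <= y <= d -> ex_CInt (fun t => f (t, y)) a b)
    by (intros; apply ex_CInt_h; [lra | intros; apply H; lra]).
  assert (E2 : forall x, a <= x <= b -> ex_CInt (fun t => f (x, t)) c d)
    by (intros; apply ex_CInt_v; [lra | intros; apply H; lra]).
  assert (D1 := fun y Hy => CInt_correct _ _ _ (E1 y Hy)).
  assert (D2 := fun x Hx => CInt_correct _ _ _ (E2 x Hx)).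
  (* Opposite sides are paired: the difference of [f] at facing points is nearly the constant
     displacement times [l]. The two resulting constants, (b - a) i (c - d) l and i (d - c) (b - a)
     l, cancel. *)
  assert (HR2 : forall x y x' y', a <= x <= b -> c <= y <= d -> a <= x' <= b ->
     c <= y' <= d ->
     Cmod (f (x, y) - f (x', y') - ((x - x')%R, (y - y')%R) * l) <= 2 * (eps * D)).
  { intros x y x' y' Hx Hy Hx' Hy'.
    replace (f (x, y) - f (x', y') - ((x - x')%R, (y - y')%R) * l)%C with
      ((f (x, y) - f z0 - ((x, y) - z0) * l) +
       - (f (x', y') - f z0 - ((x', y') - z0) * l))%C.
    - eapply Rle_trans; [apply Cmod_triangle|]. rewrite Cmod_opp.
      assert (A1 := HR x y Hx Hy). assert (A2 := HR x' y' Hx' Hy'). lra.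
    - replace (x - x', y - y') with ((x, y) - (x', y'))%C by reflexivity. ring. }
  assert (B1 : Cmod ((CInt (fun t => f (t, c)) a b - CInt (fun t => f (t, d)) a b) -
                 RtoC (b - a) * ((0%R, (c - d)%R) * l)) <= (b - a) * (2 * (eps * D))).
  { apply (CInt_norm_le (fun t => f (t, c) - f (t, d))%C); [exact Hab| |].
    - intros t Ht. replace 0 with (t - t) by ring. apply HR2; lra.
    - apply is_CInt_minus; apply D1; lra. }
  assert (B2 : Cmod ((CInt (fun t => f (b, t)) c d - CInt (fun t => f (a, t)) c d) -
                 RtoC (d - c) * (((b - a)%R, 0%R) * l)) <= (d - c) * (2 * (eps * D))).
  { apply (CInt_norm_le (fun t => f (b, t) - f (a, t))%C); [exact Hcd| |].
    - intros t Ht. replace 0 with (t - t) by ring. apply HR2; lra.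
    - apply is_CInt_minus; apply D2; lra. }
  unfold rect_int.
  set (u := (CInt _ a b - CInt _ a b)%C) in *.
  set (v := (CInt _ c d - CInt _ c d)%C) in *.
  replace (u + Ci * v)%C with
    ((u - RtoC (b - a) * ((0%R, (c - d)%R) * l)) +
     Ci * (v - RtoC (d - c) * (((b - a)%R, 0%R) * l)))%C.
  - eapply Rle_trans; [apply Cmod_triangle|]. rewrite Cmod_mult, Cmod_Ci.
    unfold D in *. nra.
  - replace (0, c - d) with (Ci * RtoC (c - d))%C
      by (apply injective_projections; simpl; ring).
    replace (b - a, 0) with (RtoC (b - a)) by reflexivity.
    rewrite !RtoC_minus. ring.
Qed.

Lemma nested_intervals (u v : nat -> R) :
  (forall n, u n <= u (S n)) -> (forall n, v (S n) <= v n) -> (forall n, u n <= v n) ->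
  exists x, forall n, u n <= x <= v n.
Proof.
  intros Hu Hv Huv.
  assert (Hu' : forall n m, (n <= m)%nat -> u n <= u m).
  { intros n m Hnm. induction Hnm as [|m _ IH]; [lra|]. specialize (Hu m). lra. }
  assert (Hv' : forall n m, (n <= m)%nat -> v m <= v n).
  { intros n m Hnm. induction Hnm as [|m _ IH]; [lra|]. specialize (Hv m). lra. }
  assert (Hb : forall n m, u m <= v n).
  { intros n m. destruct (Nat.le_ge_cases n m) as [L|L].
    - specialize (Hv' n m L). specialize (Huv m). lra.
    - specialize (Hu' m n L). specialize (Huv n). lra. }
  destruct (completeness (fun x => exists n, x = u n)) as [x [H1 H2]].
  - exists (v 0%nat). intros y [n ->]. apply Hb.
  - exists (u 0%nat), 0%nat. reflexivity.
  - exists x. intros n. split.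
    + apply H1. exists n. reflexivity.
    + apply H2. intros y [m ->]. apply Hb.
Qed.

(** * Goursat's argument: repeated quartering of the rectangle *)

Section Quartering.

Variables (f : C -> C) (a b c d : R).
Hypotheses (Hab : a <= b) (Hcd : c <= d) (Hf : holo_rect f a b c d).

Let sub_int (x y s : R) : C := rect_int f x (x + s * (b - a)) y (y + s * (d - c)).

(** A subrectangle is recorded by its lower left corner and its scale [s] relative to the original.
    The first quarter whose integral exceeds [bound] is selected; the fourth is the default,
    justified by [quarterP]. *)
Let quarter (bound s : R) (p : R * R) : R * R :=
  let x' := fst p + s * (b - a) in
  let y' := snd p + s * (d - c) in
  if Rlt_dec bound (Cmod (sub_int (fst p) (snd p) s)) then p
  else if Rlt_dec bound (Cmod (sub_int x' (snd p) s)) then (x', snd p)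
  else if Rlt_dec bound (Cmod (sub_int (fst p) y' s)) then (fst p, y')
  else (x', y').

Let inside (x y s : R) : Prop :=
  a <= x /\ x + s * (b - a) <= b /\ c <= y /\ y + s * (d - c) <= d.

(** The integral over the large rectangle is the sum of those over its four quarters, so if the
    first three stay within [bound] the fourth has to exceed it. *)
Lemma quarterP (bound s : R) (p : R * R) :
  0 <= s -> inside (fst p) (snd p) (2 * s) ->
  4 * bound < Cmod (sub_int (fst p) (snd p) (2 * s)) ->
  let q := quarter bound s p in
  bound < Cmod (sub_int (fst q) (snd q) s) /\
  (fst q = fst p \/ fst q = fst p + s * (b - a)) /\
  (snd q = snd p \/ snd q = snd p + s * (d - c)).
Proof.
  intros Hs [Hx1 [Hx2 [Hy1 Hy2]]] HB. destruct p as [x y]; simpl fst in *; simpl snd in *.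
  unfold quarter; simpl.
  destruct (Rlt_dec bound (Cmod (sub_int x y s))) as [L1|L1]; [auto|].
  destruct (Rlt_dec bound (Cmod (sub_int (x + s * (b - a)) y s))) as [L2|L2]; [simpl; auto|].
  destruct (Rlt_dec bound (Cmod (sub_int x (y + s * (d - c)) s))) as [L3|L3]; [simpl; auto|].
  simpl. split; [|auto].
  assert (Hw : 0 <= s * (b - a)) by (apply Rmult_le_pos; lra).
  assert (Hh : 0 <= s * (d - c)) by (apply Rmult_le_pos; lra).
  assert (E : sub_int x y (2 * s) =
    ((sub_int x y s + sub_int x (y + s * (d - c)) s) +
     (sub_int (x + s * (b - a)) y s + sub_int (x + s * (b - a)) (y + s * (d - c)) s))%C).
  { unfold sub_int.
    replace (x + 2 * s * (b - a)) with (x + s * (b - a) + s * (b - a)) by ring.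
    replace (y + 2 * s * (d - c)) with (y + s * (d - c) + s * (d - c)) by ring.
    rewrite (rect_int_split_x f x (x + s * (b - a))).
    - rewrite (rect_int_split_y f x (x + s * (b - a)) y (y + s * (d - c))).
      + rewrite (rect_int_split_y f (x + s * (b - a)) _ y (y + s * (d - c))).
        * reflexivity.
        * lra.
        * lra.
        * intros x' y' Hx' Hy'. apply Hf; lra.
      + lra.
      + lra.
      + intros x' y' Hx' Hy'. apply Hf; lra.
    - lra.
    - lra.
    - intros x' y' Hx' Hy'. apply Hf; lra. }
  rewrite E in HB.
  assert (T1 := Cmod_triangle (sub_int x y s + sub_int x (y + s * (d - c)) s)
    (sub_int (x + s * (b - a)) y s + sub_int (x + s * (b - a)) (y + s * (d - c)) s)).
  assert (T2 := Cmod_triangle (sub_int x y s) (sub_int x (y + s * (d - c)) s)).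
  assert (T3 := Cmod_triangle (sub_int (x + s * (b - a)) y s)
    (sub_int (x + s * (b - a)) (y + s * (d - c)) s)).
  lra.
Qed.

Theorem goursat : rect_int f a b c d = RtoC 0.
Proof.
  apply Cmod_eq_0. apply Rle_antisym; [|apply Cmod_ge_0].
  apply Rnot_lt_le. intros Hpos.
  set (D := (b - a) + (d - c)).
  assert (HD : 0 <= D) by (unfold D; lra).
  set (I := Cmod (rect_int f a b c d)) in *.
  set (s := fun n : nat => (/ 2) ^ n).
  assert (Hs : forall n, 0 < s n) by (intros n; apply pow_lt; lra).
  assert (Hs2 : forall n, s n = 2 * s (S n)) by (intros n; unfold s; simpl; lra).
  (* Halving the scale divides the threshold by 4. The factor 1/2 makes the inequality strict at the
     initial rectangle, where the integral has modulus exactly [I]. *)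
  set (p := fix p n := match n with
     O => (a, c) | S m => quarter (I / 2 * (s (S m)) ^ 2) (s (S m)) (p m) end).
  assert (HP : forall n, inside (fst (p n)) (snd (p n)) (s n) /\
     I / 2 * (s n) ^ 2 < Cmod (sub_int (fst (p n)) (snd (p n)) (s n))).
  { intros n. induction n as [|n [IH1 IH2]].
    - simpl. split; [unfold inside, s; simpl; lra|].
      unfold s, sub_int; simpl.
      replace (a + 1 * (b - a)) with b by ring. replace (c + 1 * (d - c)) with d by ring.
      fold I. lra.
    - rewrite (Hs2 n) in IH1, IH2.
      destruct (quarterP (I / 2 * (s (S n)) ^ 2) (s (S n)) (p n)) as [Q1 [Q2 Q3]].
      + apply Rlt_le, Hs.
      + exact IH1.
      + eapply Rle_lt_trans; [|exact IH2]. lra.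
      + change (p (S n)) with (quarter (I / 2 * (s (S n)) ^ 2) (s (S n)) (p n)).
        split; [|exact Q1]. destruct IH1 as [A1 [A2 [A3 A4]]].
        assert (Hw : 0 <= s (S n) * (b - a)) by (apply Rmult_le_pos; [apply Rlt_le, Hs|lra]).
        assert (Hh : 0 <= s (S n) * (d - c)) by (apply Rmult_le_pos; [apply Rlt_le, Hs|lra]).
        unfold inside. destruct Q2 as [-> | ->], Q3 as [-> | ->]; lra. }
  assert (HS : forall n,
     (fst (p (S n)) = fst (p n) \/ fst (p (S n)) = fst (p n) + s (S n) * (b - a)) /\
     (snd (p (S n)) = snd (p n) \/ snd (p (S n)) = snd (p n) + s (S n) * (d - c))).
  { intros n. destruct (HP n) as [IH1 IH2]. rewrite (Hs2 n) in IH1, IH2.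
    destruct (quarterP (I / 2 * (s (S n)) ^ 2) (s (S n)) (p n)) as [_ Q].
    + apply Rlt_le, Hs.
    + exact IH1.
    + eapply Rle_lt_trans; [|exact IH2]. lra.
    + exact Q. }
  assert (Hw : forall n, 0 <= s n * (b - a)) by (intros n; apply Rmult_le_pos; [apply Rlt_le, Hs|lra]).
  assert (Hh : forall n, 0 <= s n * (d - c)) by (intros n; apply Rmult_le_pos; [apply Rlt_le, Hs|lra]).
  destruct (nested_intervals (fun n => fst (p n)) (fun n => fst (p n) + s n * (b - a)))
    as [x Hx].
  { intros n. destruct (proj1 (HS n)) as [-> | ->]; specialize (Hw (S n)); lra. }
  { intros n. rewrite (Hs2 n). destruct (proj1 (HS n)) as [-> | ->];
    specialize (Hw (S n)); lra. }
  { intros n; specialize (Hw n); lra. }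
  destruct (nested_intervals (fun n => snd (p n)) (fun n => snd (p n) + s n * (d - c)))
    as [y Hy].
  { intros n. destruct (proj2 (HS n)) as [-> | ->]; specialize (Hh (S n)); lra. }
  { intros n. rewrite (Hs2 n). destruct (proj2 (HS n)) as [-> | ->];
    specialize (Hh (S n)); lra. }
  { intros n; specialize (Hh n); lra. }
  assert (Hxab : a <= x <= b) by (specialize (Hx 0%nat); unfold s in Hx; simpl in Hx; lra).
  assert (Hycd : c <= y <= d) by (specialize (Hy 0%nat); unfold s in Hy; simpl in Hy; lra).
  destruct (Hf x y Hxab Hycd) as [l Hl].
  (* Chosen so that 2 eps D^2 <= I / 2; adding 1 avoids a division by zero for a degenerate
     rectangle. *)
  set (eps := I / (4 * (D ^ 2 + 1))).
  assert (HD2 : 0 < D ^ 2 + 1) by (assert (H2 := pow2_ge_0 D); lra).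
  assert (Heps : 0 < eps) by (apply Rdiv_lt_0_compat; lra).
  destruct (proj1 (Cderiv_eps _ _ _) Hl eps Heps) as [r [Hr HH]].
  (* At this stage the whole rectangle, of half-perimeter [s n * D], lies within distance [r] of the
     limit point, where the linear approximation is valid. *)
  destruct (pow_lt_1_zero (/ 2) ltac:(rewrite Rabs_pos_eq; lra) (r / (D + 1))) as [n Hn].
  { apply Rdiv_lt_0_compat; lra. }
  specialize (Hn n (Nat.le_refl n)). fold (s n) in Hn.
  rewrite Rabs_pos_eq in Hn by (apply Rlt_le, Hs).
  apply Rmult_lt_compat_r with (r := D + 1) in Hn; [|lra].
  replace (r / (D + 1) * (D + 1)) with r in Hn by (field; lra).
  destruct (HP n) as [[A1 [A2 [A3 A4]]] HB].
  specialize (Hx n). specialize (Hy n). simpl in Hx, Hy.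
  assert (Hwn := Hw n). assert (Hhn := Hh n). assert (Hsn := Hs n).
  assert (Hfin : Cmod (sub_int (fst (p n)) (snd (p n)) (s n)) <= 2 * eps * (s n * D) ^ 2).
  { unfold sub_int. replace (s n * D) with
      ((fst (p n) + s n * (b - a) - fst (p n)) + (snd (p n) + s n * (d - c) - snd (p n)))
      by (unfold D; ring).
    apply (rect_int_small f _ _ _ _ eps (x, y) l); try lra; simpl; try lra.
    - intros x' y' Hx' Hy'. apply Hf; lra.
    - intros x' y' Hx' Hy'. apply HH.
      apply Rle_lt_trans with (2 := Hn).
      eapply Rle_trans; [apply Cmod_le_Rabs|]. simpl.
      apply Rle_trans with (s n * (b - a) + s n * (d - c)).
      + apply Rplus_le_compat; apply Rabs_le; lra.
      + unfold D. lra. }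
  assert (HI : eps * (D ^ 2 + 1) = I / 4) by (unfold eps; field; lra).
  assert (2 * eps * (s n * D) ^ 2 <= I / 2 * s n ^ 2).
  { replace (2 * eps * (s n * D) ^ 2) with ((eps * D ^ 2) * (2 * s n ^ 2)) by ring.
    replace (I / 2 * s n ^ 2) with (I / 4 * (2 * s n ^ 2)) by field.
    apply Rmult_le_compat_r; [assert (Hq := pow2_ge_0 (s n)); lra|]. lra. }
  lra.
Qed.

End Quartering.

(** * Series *)

Notation Csum := (@sum_n C_Ring).
Notation Rsum := (@sum_n R_Ring).
Notation is_Cseries := (@is_series C_AbsRing C_NormedModule).

Lemma sum_n_zero {G : AbelianMonoid} (u : nat -> G) (n : nat) :
  (forall k, (k <= n)%nat -> u k = zero) -> sum_n u n = zero.
Proof.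
  intros H. rewrite (sum_n_ext_loc u (fun _ => zero) n H). apply sum_n_m_const_zero.
Qed.

Lemma sum_n_trunc {G : AbelianMonoid} (u : nat -> G) (n m : nat) :
  (n <= m)%nat -> (forall k, (n < k)%nat -> u k = zero) -> sum_n u m = sum_n u n.
Proof.
  intros Hnm H. induction Hnm as [|m Hm IH]; [reflexivity|].
  rewrite sum_Sn, IH, H, plus_zero_r by lia. reflexivity.
Qed.

Lemma sum_n_single {G : AbelianMonoid} (u : nat -> G) (n m : nat) :
  (m <= n)%nat -> (forall k, k <> m -> u k = zero) -> sum_n u n = u m.
Proof.
  intros Hmn H. rewrite (sum_n_trunc u m n Hmn) by (intros; apply H; lia).
  destruct m as [|m]; [apply sum_O|].
  rewrite sum_Sn, (sum_n_zero u m), plus_zero_l by (intros; apply H; lia). reflexivity.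
Qed.

Lemma Rsum_le (u v : nat -> R) (n : nat) :
  (forall k, u k <= v k) -> Rsum u n <= Rsum v n.
Proof. intros H. apply sum_n_m_le. exact H. Qed.

Lemma Rsum_S (u : nat -> R) (n : nat) : Rsum u (S n) = Rsum u n + u (S n).
Proof. apply (sum_Sn (G := R_Ring)). Qed.

Lemma Csum_S (u : nat -> C) (n : nat) : Csum u (S n) = (Csum u n + u (S n))%C.
Proof. apply (sum_Sn (G := C_Ring)). Qed.

Lemma Csum_0 (u : nat -> C) : Csum u 0 = u 0%nat.
Proof. apply (sum_O (G := C_Ring)). Qed.

Lemma Rsum_0 (u : nat -> R) : Rsum u 0 = u 0%nat.
Proof. apply (sum_O (G := R_Ring)). Qed.

Lemma Rsum_ge0 (u : nat -> R) (n : nat) : (forall k, 0 <= u k) -> 0 <= Rsum u n.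
Proof.
  intros H. induction n as [|n IH]; [rewrite Rsum_0; apply H|].
  rewrite Rsum_S. specialize (H (S n)). lra.
Qed.

Lemma Rsum_incr (u : nat -> R) (n m : nat) :
  (forall k, 0 <= u k) -> (n <= m)%nat -> Rsum u n <= Rsum u m.
Proof.
  intros H Hnm. induction Hnm as [|m Hm IH]; [lra|]. rewrite Rsum_S.
  specialize (H (S m)). lra.
Qed.

Lemma Cmod_Csum_le (u : nat -> C) (n : nat) :
  Cmod (Csum u n) <= Rsum (fun k => Cmod (u k)) n.
Proof. apply (norm_sum_n_m (V := C_NormedModule)). Qed.

Lemma is_Cseries_eps (u : nat -> C) (l : C) :
  is_Cseries u l <->
  forall eps, 0 < eps -> exists N, forall n, (N <= n)%nat -> Cmod (Csum u n - l) < eps.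
Proof.
  unfold is_series.
  rewrite (filterlim_locally_ball_norm (U := C_NormedModule)). split.
  - intros H eps Heps. destruct (H (mkposreal eps Heps)) as [N HN].
    exists N. intros n Hn. exact (HN n Hn).
  - intros H eps. destruct (H eps (cond_pos eps)) as [N HN].
    exists N. intros n Hn. exact (HN n Hn).
Qed.

Lemma is_Cseries_bound (u : nat -> C) (l : C) (B : R) :
  is_Cseries u l -> (forall n, Cmod (Csum u n) <= B) -> Cmod l <= B.
Proof.
  intros H HB. apply Rnot_lt_le. intros Hlt.
  destruct (proj1 (is_Cseries_eps _ _) H (Cmod l - B)) as [N HN]; [lra|].
  specialize (HN N (Nat.le_refl N)). specialize (HB N).
  assert (T := Cmod_triangle (Csum u N) (- (Csum u N - l))).
  replace (Csum u N + - (Csum u N - l))%C with l in T by ring.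
  rewrite Cmod_opp in T. lra.
Qed.

Lemma ex_series_bounded (u : nat -> R) (B : R) :
  (forall k, 0 <= u k) -> (forall n, Rsum u n <= B) -> ex_series u.
Proof.
  intros H HB. destruct (ex_finite_lim_seq_incr (Rsum u) B) as [l Hl].
  - intros n. apply Rsum_incr; [exact H|lia].
  - exact HB.
  - exists l. exact Hl.
Qed.

Lemma Rsum_le_Series (u : nat -> R) (n : nat) :
  (forall k, 0 <= u k) -> ex_series u -> Rsum u n <= Series u.
Proof.
  intros H Hex. apply Series_correct in Hex.
  apply (is_lim_seq_incr_compare (Rsum u)); [exact Hex|].
  intros m. apply Rsum_incr; [exact H|lia].
Qed.

Lemma ex_Cseries_bounded (u : nat -> C) (B : R) :
  (forall n, Rsum (fun k => Cmod (u k)) n <= B) -> exists l, is_Cseries u l.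
Proof.
  intros HB.
  apply (ex_series_le (V := C_CompleteNormedModule) u (fun k => Cmod (u k))).
  - intros n. apply Rle_refl.
  - apply (ex_series_bounded _ B); [intros; apply Cmod_ge_0|exact HB].
Qed.

Lemma is_Cseries_terms_bounded (u : nat -> C) (l : C) :
  is_Cseries u l -> exists B, forall k, Cmod (u k) <= B.
Proof.
  intros H. destruct (proj1 (is_Cseries_eps _ _) H 1) as [N HN]; [lra|].
  (* Past index N + 1 a term is the difference of two partial sums, each within 1 of the limit. *)
  exists (2 + Rsum (fun k => Cmod (u k)) (S N)). intros k.
  destruct (Nat.le_gt_cases k (S N)) as [L|L].
  - assert (Cmod (u k) <= Rsum (fun k => Cmod (u k)) (S N)); [|lra].
    apply Rle_trans with (Rsum (fun k => Cmod (u k)) k).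
    + destruct k as [|k]; [rewrite Rsum_0; lra|].
      rewrite Rsum_S.
      assert (0 <= Rsum (fun k => Cmod (u k)) k)
        by (apply Rsum_ge0; intros; apply Cmod_ge_0).
      lra.
    + apply Rsum_incr; [intros; apply Cmod_ge_0|exact L].
  - destruct k as [|k]; [lia|].
    assert (H1 := HN (S k) ltac:(lia)). assert (H2 := HN k ltac:(lia)).
    rewrite Csum_S in H1.
    assert (T := Cmod_triangle (Csum u k + u (S k) - l) (- (Csum u k - l))).
    replace (Csum u k + u (S k) - l + - (Csum u k - l))%C with (u (S k)) in T by ring.
    rewrite Cmod_opp in T.
    assert (0 <= Rsum (fun k => Cmod (u k)) (S N))
      by (apply Rsum_ge0; intros; apply Cmod_ge_0).
    lra.
Qed.

(** * Dirichlet convolution *)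

(* Indices are shifted: [u i] is the coefficient of [(i + 1)^(-s)]. *)
Definition dconv {K : Ring} (u v : nat -> K) (n : nat) : K :=
  sum_n (fun i => sum_n (fun j =>
    if (S i * S j =? S n)%nat then mult (u i) (v j) else zero) n) n.

(** Lattice points under the hyperbola (i + 1)(j + 1) = N + 1. This region lies between two squares,
    which allows a comparison with products of ordinary partial sums. *)
Definition hyperbola_sum {K : Ring} (u v : nat -> K) (N : nat) : K :=
  sum_n (fun i => sum_n (fun j =>
    if (S i * S j <=? S N)%nat then mult (u i) (v j) else zero) N) N.

Definition dunit (n : nat) : C := if (n =? 0)%nat then RtoC 1 else RtoC 0.

Definition tail1 {K : Ring} (u : nat -> K) (i : nat) : K :=
  match i with O => zero | S _ => u i end.

(** All ranges are first enlarged to N, which adds only zero terms; after exchanging the sums, each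
    pair (i, j) under the hyperbola is met for exactly one n, namely (i + 1)(j + 1) - 1. *)
Lemma sum_dconv {K : Ring} (u v : nat -> K) (N : nat) :
  sum_n (dconv u v) N = hyperbola_sum u v N.
Proof.
  transitivity (sum_n (fun n => sum_n (fun i => sum_n (fun j =>
    if (S i * S j =? S n)%nat then mult (u i) (v j) else zero) N) N) N).
  - apply sum_n_ext_loc. intros n Hn. unfold dconv. symmetry.
    rewrite (sum_n_trunc _ n N Hn).
    + apply sum_n_ext. intros i. apply (sum_n_trunc _ n N Hn).
      intros k Hk. destruct (Nat.eqb_spec (S i * S k) (S n)); [nia|reflexivity].
    + intros k Hk. apply sum_n_zero. intros j _.
      destruct (Nat.eqb_spec (S k * S j) (S n)); [nia|reflexivity].
  - rewrite sum_n_switch. apply sum_n_ext. intros i. cbv beta.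
    rewrite sum_n_switch. apply sum_n_ext. intros j. cbv beta.
    destruct (Nat.leb_spec (S i * S j) (S N)) as [L|L].
    + rewrite (sum_n_single _ N (pred (S i * S j))).
      * destruct (Nat.eqb_spec (S i * S j) (S (pred (S i * S j)))); [reflexivity|lia].
      * lia.
      * intros k Hk. destruct (Nat.eqb_spec (S i * S j) (S k)); [lia|reflexivity].
    + apply sum_n_zero. intros k Hk.
      destruct (Nat.eqb_spec (S i * S j) (S k)); [lia|reflexivity].
Qed.

Lemma dconv_split {K : Ring} (u v : nat -> K) (n : nat) :
  dconv u v n = plus (mult (u O) (v n)) (dconv (tail1 u) v n).
Proof.
  transitivity (plus (sum_n (fun i => match i with
      O => mult (u O) (v n) | S _ => zero end) n) (dconv (tail1 u) v n)).
  - unfold dconv. rewrite <- sum_n_plus. apply sum_n_ext. intros [|i].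
    + rewrite (sum_n_single _ n n).
      * rewrite (sum_n_zero (fun j => if (1 * S j =? S n)%nat then _ else _) n).
        -- rewrite plus_zero_r, Nat.mul_1_l, Nat.eqb_refl. reflexivity.
        -- intros k _. unfold tail1. rewrite mult_zero_l. destruct (_ =? _)%nat; reflexivity.
      * lia.
      * intros k Hk. destruct (Nat.eqb_spec (1 * S k) (S n)); [lia|reflexivity].
    + rewrite plus_zero_l. reflexivity.
  - rewrite (sum_n_single _ n 0); [reflexivity|lia|].
    intros [|k] Hk; [congruence|reflexivity].
Qed.

(** For i >= 1 the relation (i + 1)(j + 1) = n + 1 forces j < n. This makes the recursion for the
    Dirichlet inverse well founded. *)
Lemma dconv_tail1_ext {K : Ring} (u v w : nat -> K) (n : nat) :
  (forall j, (j < n)%nat -> v j = w j) -> dconv (tail1 u) v n = dconv (tail1 u) w n.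
Proof.
  intros H. unfold dconv. apply sum_n_ext. intros [|i]; apply sum_n_ext; intros j.
  - unfold tail1. rewrite !mult_zero_l. reflexivity.
  - destruct (Nat.eqb_spec (S (S i) * S j) (S n)); [|reflexivity].
    rewrite H by nia. reflexivity.
Qed.

Lemma Cmod_dconv_le (u v : nat -> C) (n : nat) :
  Cmod (dconv (K := C_Ring) u v n) <=
  dconv (K := R_Ring) (fun i => Cmod (u i)) (fun j => Cmod (v j)) n.
Proof.
  unfold dconv. eapply Rle_trans; [apply Cmod_Csum_le|].
  apply Rsum_le. intros i. eapply Rle_trans; [apply Cmod_Csum_le|].
  apply Rsum_le. intros j. destruct (_ =? _)%nat.
  - apply Req_le, Cmod_mult.
  - apply Req_le, Cmod_0.
Qed.

Lemma sum_n_prod {K : Ring} (u v : nat -> K) (m n : nat) :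
  mult (sum_n u m) (sum_n v n) = sum_n (fun i => sum_n (fun j => mult (u i) (v j)) n) m.
Proof.
  rewrite <- sum_n_mult_r. apply sum_n_ext. intros i. symmetry. apply sum_n_mult_l.
Qed.

Lemma hyperbola_sum_le_prod (u v : nat -> R) (N : nat) :
  (forall i, 0 <= u i) -> (forall j, 0 <= v j) ->
  hyperbola_sum (K := R_Ring) u v N <= Rsum u N * Rsum v N.
Proof.
  intros Hu Hv.
  change (Rsum u N * Rsum v N) with (@mult R_Ring (Rsum u N) (Rsum v N)).
  rewrite sum_n_prod. apply Rsum_le. intros i. apply Rsum_le. intros j.
  destruct (_ <=? _)%nat; [apply Rle_refl|]. apply Rmult_le_pos; auto.
Qed.

(** The square of indices up to m lies under the hyperbola as soon as (m + 1)^2 <= N + 1. *)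
Lemma hyperbola_sum_ge_prod (u v : nat -> R) (m N : nat) :
  (forall i, 0 <= u i) -> (forall j, 0 <= v j) -> (S m * S m <= S N)%nat ->
  Rsum u m * Rsum v m <= hyperbola_sum (K := R_Ring) u v N.
Proof.
  intros Hu Hv HmN.
  change (Rsum u m * Rsum v m) with (@mult R_Ring (Rsum u m) (Rsum v m)).
  rewrite sum_n_prod. unfold hyperbola_sum.
  assert (P : forall i j, 0 <= mult (K := R_Ring) (u i) (v j))
    by (intros; apply Rmult_le_pos; auto).
  assert (P' : forall i j, 0 <= if (S i * S j <=? S N)%nat
                            then mult (K := R_Ring) (u i) (v j) else zero)
    by (intros i j; destruct (_ <=? _)%nat; [apply P|apply Rle_refl]).
  apply Rle_trans with (Rsum (fun i => Rsum (fun j =>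
     if (S i * S j <=? S N)%nat then mult (u i) (v j) else zero) N) m).
  - rewrite (sum_n_ext_loc _ (fun i => Rsum (fun j =>
     if (S i * S j <=? S N)%nat then mult (u i) (v j) else zero) m)).
    + apply Rsum_le. intros i. apply Rsum_incr; [auto|nia].
    + intros i Hi. apply sum_n_ext_loc. intros j Hj.
      destruct (Nat.leb_spec (S i * S j) (S N)); [reflexivity|nia].
  - apply Rsum_incr; [|nia]. intros i. apply Rsum_ge0. auto.
Qed.

Lemma Cmod_prod_sub_hyperbola_le (u v : nat -> C) (N : nat) :
  Cmod (Csum u N * Csum v N - hyperbola_sum (K := C_Ring) u v N) <=
  Rsum (fun i => Cmod (u i)) N * Rsum (fun j => Cmod (v j)) N -
  hyperbola_sum (K := R_Ring) (fun i => Cmod (u i)) (fun j => Cmod (v j)) N.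
Proof.
  (* The part of the square lying above the hyperbola. It is the same index set for the products and
     for their moduli, so the triangle inequality applies term by term. *)
  set (t := fun i j => if (S i * S j <=? S N)%nat then RtoC 0 else (u i * v j)%C).
  assert (EC : mult (K := C_Ring) (Csum u N) (Csum v N) =
    plus (hyperbola_sum (K := C_Ring) u v N) (Csum (fun i => Csum (t i) N) N)).
  { rewrite sum_n_prod. unfold hyperbola_sum. rewrite <- sum_n_plus.
    apply sum_n_ext. intros i. rewrite <- sum_n_plus. apply sum_n_ext. intros j.
    unfold t. destruct (_ <=? _)%nat; symmetry;
      [apply (plus_zero_r (G := C_Ring))|apply (plus_zero_l (G := C_Ring))]. }
  assert (ER : mult (K := R_Ring) (Rsum (fun i => Cmod (u i)) N) (Rsum (fun i => Cmod (v i)) N) =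
    plus (hyperbola_sum (K := R_Ring) (fun i => Cmod (u i)) (fun j => Cmod (v j)) N)
         (Rsum (fun i => Rsum (fun j => Cmod (t i j)) N) N)).
  { rewrite sum_n_prod. unfold hyperbola_sum. rewrite <- sum_n_plus.
    apply sum_n_ext. intros i. rewrite <- sum_n_plus. apply sum_n_ext. intros j.
    unfold t. destruct (_ <=? _)%nat; symmetry; [rewrite Cmod_0; apply (plus_zero_r (G := R_Ring))|].
    rewrite Cmod_mult. apply (plus_zero_l (G := R_Ring)). }
  change (Csum u N * Csum v N)%C with (mult (K := C_Ring) (Csum u N) (Csum v N)).
  change (Rsum (fun i => Cmod (u i)) N * Rsum (fun i => Cmod (v i)) N)
    with (mult (K := R_Ring) (Rsum (fun i => Cmod (u i)) N) (Rsum (fun i => Cmod (v i)) N)).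
  rewrite EC, ER.
  set (h := hyperbola_sum (K := C_Ring) u v N).
  set (h' := hyperbola_sum (K := R_Ring) _ _ N).
  set (x := Csum _ N). set (x' := Rsum _ N).
  change (Cmod (h + x - h) <= h' + x' - h').
  assert (E : forall y z : C, (y + z - y)%C = z) by (intros; ring).
  assert (E' : forall y z : R, y + z - y = z) by (intros; ring).
  rewrite (E h x), (E' h' x').
  eapply Rle_trans; [apply Cmod_Csum_le|]. apply Rsum_le. intros i. apply Cmod_Csum_le.
Qed.

Lemma Cmod_prod_sub_le (u v : nat -> C) (N m : nat) :
  (S m * S m <= S N)%nat ->
  Cmod (Csum u N * Csum v N - hyperbola_sum (K := C_Ring) u v N) <=
  Rsum (fun i => Cmod (u i)) N * Rsum (fun j => Cmod (v j)) N -
  Rsum (fun i => Cmod (u i)) m * Rsum (fun j => Cmod (v j)) m.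
Proof.
  intros H. eapply Rle_trans; [apply Cmod_prod_sub_hyperbola_le|].
  assert (A := hyperbola_sum_ge_prod (fun i => Cmod (u i)) (fun j => Cmod (v j)) m N
    (fun i => Cmod_ge_0 _) (fun j => Cmod_ge_0 _) H). lra.
Qed.

(** All partial sums of the convolution equal 1, so only the gap between a product of partial sums
    and the hyperbola sum has to vanish. The gap is at most the difference of the products of
    absolute partial sums at N and at m, and these products converge. *)
Lemma Cseries_prod_of_dconv_one (u v : nat -> C) (U V : R) (k l : C) :
  (forall n, Rsum (fun i => Cmod (u i)) n <= U) ->
  (forall n, Rsum (fun i => Cmod (v i)) n <= V) ->
  (forall n, dconv (K := C_Ring) u v n = dunit n) ->
  is_Cseries u k -> is_Cseries v l -> (k * l)%C = RtoC 1.
Proof.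
  intros HU HV Huv Hk Hl.
  assert (Pu : forall i, 0 <= Cmod (u i)) by (intros; apply Cmod_ge_0).
  assert (Pv : forall i, 0 <= Cmod (v i)) by (intros; apply Cmod_ge_0).
  assert (Hh : forall N, hyperbola_sum (K := C_Ring) u v N = RtoC 1).
  { intros N. rewrite <- sum_dconv. rewrite (sum_n_single _ N 0).
    - rewrite Huv. reflexivity.
    - lia.
    - intros [|n] Hn; [congruence|]. rewrite Huv. reflexivity. }
  set (a := Rsum (fun i => Cmod (u i))) in *. set (b := Rsum (fun i => Cmod (v i))) in *.
  assert (Eu := ex_series_bounded _ U Pu HU). assert (Ev := ex_series_bounded _ V Pv HV).
  assert (Lab := is_lim_seq_mult' a b _ _ (Series_correct _ Eu) (Series_correct _ Ev)).
  set (L := Series (fun i => Cmod (u i)) * Series (fun i => Cmod (v i))) in *.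
  assert (HL : forall N, a N * b N <= L).
  { intros N. apply Rmult_le_compat; try (apply Rsum_ge0; assumption);
    apply Rsum_le_Series; assumption. }
  assert (HV0 : 0 <= V).
  { apply Rle_trans with (b 0%nat); [apply Rsum_ge0; assumption|apply HV]. }
  assert (Hk0 := Cmod_ge_0 k).
  enough (HE : forall eps, 0 < eps -> Cmod (k * l - 1) <= eps * (1 + V + Cmod k)).
  { assert (E : (k * l - 1)%C = RtoC 0).
    { apply Cmod_eq_0, Rle_antisym; [|apply Cmod_ge_0]. apply Rnot_lt_le. intros H.
      specialize (HE (Cmod (k * l - 1) / (2 * (1 + V + Cmod k)))).
      assert (0 < Cmod (k * l - 1) / (2 * (1 + V + Cmod k)))
        by (apply Rdiv_lt_0_compat; lra).
      specialize (HE H0).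
      replace (Cmod (k * l - 1) / (2 * (1 + V + Cmod k)) * (1 + V + Cmod k))
        with (Cmod (k * l - 1) / 2) in HE by (field; lra). lra. }
    replace (k * l)%C with ((k * l - 1) + 1)%C by ring. rewrite E. ring. }
  intros eps Heps.
  destruct (proj1 (is_Cseries_eps _ _) Hk eps Heps) as [N1 H1].
  destruct (proj1 (is_Cseries_eps _ _) Hl eps Heps) as [N2 H2].
  apply is_lim_seq_spec in Lab. destruct (Lab (mkposreal eps Heps)) as [m Hm].
  specialize (Hm m (Nat.le_refl m)). simpl in Hm. apply Rabs_lt_between in Hm.
  (* Large enough for both series to be within [eps] of their sums and for the square up to [m] to
     fit under the hyperbola of [N]. *)
  set (N := (S m * S m + N1 + N2)%nat).
  specialize (H1 N ltac:(lia)). specialize (H2 N ltac:(lia)).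
  assert (H3 := Cmod_prod_sub_le u v N m ltac:(lia)). rewrite Hh in H3.
  fold (a N) (b N) (a m) (b m) in H3. specialize (HL N).
  assert (H4 : Cmod (Csum v N) <= V)
    by (eapply Rle_trans; [apply Cmod_Csum_le|apply HV]).
  set (x := Csum u N) in *. set (y := Csum v N) in *.
  assert (T : forall x y : C,
    (k * l - 1 = - ((x - k) * y) + - (k * (y - l)) + (x * y - 1))%C) by (intros; ring).
  rewrite (T x y).
  eapply Rle_trans; [apply Cmod_triangle|].
  eapply Rle_trans; [apply Rplus_le_compat_r, Cmod_triangle|].
  rewrite !Cmod_opp, !Cmod_mult.
  assert (A1 := Cmod_ge_0 (x - k)). assert (A2 := Cmod_ge_0 y).
  assert (B1 : Cmod (x - k) * Cmod y <= eps * V) by (apply Rmult_le_compat; lra).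
  assert (B2 : Cmod k * Cmod (y - l) <= Cmod k * eps) by (apply Rmult_le_compat_l; lra).
  lra.
Qed.

(** Isolating the term with [u O] in the convolution identity, taking moduli and summing gives d V
    <= 1 + (d / 2) V, where V is a partial sum of the moduli of [v]. Being a finite sum, V can be
    absorbed on the left without knowing that the series converges. *)
Lemma dconv_inverse_summable (u v : nat -> C) (d : R) :
  0 < d -> d <= Cmod (u O) ->
  (forall n, Rsum (fun i => Cmod (tail1 (K := C_Ring) u i)) n <= d / 2) ->
  (forall n, dconv (K := C_Ring) u v n = dunit n) ->
  forall n, Rsum (fun i => Cmod (v i)) n <= 2 / d.
Proof.
  intros Hd Hu0 Ht Huv N.
  set (V := Rsum (fun i => Cmod (v i)) N).
  assert (HV : 0 <= V) by (apply Rsum_ge0; intros; apply Cmod_ge_0).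
  set (t := fun i => Cmod (tail1 (K := C_Ring) u i)) in *.
  assert (H1 : forall n, d * Cmod (v n) <= (if (n =? 0)%nat then 1 else 0) +
                dconv (K := R_Ring) t (fun i => Cmod (v i)) n).
  { intros n. apply Rle_trans with (Cmod (u O * v n)).
    - rewrite Cmod_mult. apply Rmult_le_compat_r; [apply Cmod_ge_0|exact Hu0].
    - assert (E := dconv_split (K := C_Ring) u v n). rewrite Huv in E.
      assert (E' : (u O * v n = dunit n +
         - (dconv (K := C_Ring) (tail1 (K := C_Ring) u) v n))%C).
      { rewrite E. set (w := dconv _ _ _).
        assert (A : forall x y : C, (x = x + y + - y)%C) by (intros; ring).
        apply (A (u O * v n)%C w). }
      rewrite E'. eapply Rle_trans; [apply Cmod_triangle|].
      rewrite Cmod_opp. apply Rplus_le_compat.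
      + unfold dunit. destruct (n =? 0)%nat; [rewrite Cmod_1|rewrite Cmod_0]; lra.
      + apply Cmod_dconv_le. }
  assert (H2 : d * V <= 1 + d / 2 * V).
  { apply Rle_trans with (1 + Rsum t N * V).
    - unfold V at 1.
      change (d * Rsum (fun i => Cmod (v i)) N)
        with (mult (K := R_Ring) d (Rsum (fun i => Cmod (v i)) N)).
      rewrite <- sum_n_mult_l. eapply Rle_trans; [apply Rsum_le, H1|].
      assert (E : Rsum (fun k => (if (k =? 0)%nat then 1 else 0) +
          dconv (K := R_Ring) t (fun i => Cmod (v i)) k) N =
        Rsum (fun k => if (k =? 0)%nat then 1 else 0) N +
        Rsum (dconv (K := R_Ring) t (fun i => Cmod (v i))) N)
        by apply (sum_n_plus (G := R_Ring)).
      rewrite E, sum_dconv. apply Rplus_le_compat.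
      + apply Req_le.
        apply (sum_n_single (G := R_Ring) (fun k => if (k =? 0)%nat then 1 else 0) N 0); [lia|].
        intros [|k] Hk; [congruence|reflexivity].
      + apply hyperbola_sum_le_prod; intros; apply Cmod_ge_0.
    - apply Rplus_le_compat_l, Rmult_le_compat_r; [exact HV|apply Ht]. }
  apply Rmult_le_reg_l with (d / 2); [lra|].
  replace (d / 2 * (2 / d)) with 1 by (field; lra). lra.
Qed.

(* [dinv_approx u N] is the Dirichlet inverse of [u] at the indices [n < N]: the value
   at [n] depends only on smaller indices, so iterating [N] times suffices. *)
Fixpoint dinv_approx (u : nat -> C) (N : nat) : nat -> C :=
  match N with
  | O => fun _ => RtoC 0
  | S M => fun n => ((dunit n -
      dconv (K := C_Ring) (tail1 (K := C_Ring) u) (dinv_approx u M) n) / u O)%C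
  end.

Definition dinv (u : nat -> C) (n : nat) : C := dinv_approx u (S n) n.

Lemma dinv_approx_stable (u : nat -> C) (N n : nat) :
  (n < N)%nat -> dinv_approx u N n = dinv u n.
Proof.
  revert n. induction N as [N IH] using lt_wf_ind. intros n Hn.
  destruct N as [|N]; [lia|]. unfold dinv. simpl.
  rewrite (dconv_tail1_ext u (dinv_approx u N) (dinv_approx u n)); [reflexivity|].
  intros j Hj. rewrite !IH by lia. reflexivity.
Qed.

Lemma dconv_dinv (u : nat -> C) (n : nat) :
  u O <> RtoC 0 ->
  dconv (K := C_Ring) u (dinv u) n = dunit n.
Proof.
  intros Hu. rewrite dconv_split. unfold dinv at 1. simpl dinv_approx.
  rewrite (dconv_tail1_ext u (dinv_approx u n) (dinv u))
    by (intros; apply dinv_approx_stable; assumption).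
  set (w := dconv (K := C_Ring) _ _ _).
  set (e := dunit n).
  assert (A : forall w e : C, (u O * ((e - w) / u O) + w = e)%C)
    by (intros; field; exact Hu).
  exact (A w e).
Qed.

(** The weight is completely multiplicative, as n^(-s) is; this passes from the convolution of
    coefficients to that of the terms of the series at a given point. *)
Lemma dconv_twist (w u v : nat -> C) (n : nat) :
  (forall i j m, (S i * S j = S m)%nat -> w m = (w i * w j)%C) ->
  dconv (K := C_Ring) (fun i => u i * w i)%C (fun j => v j * w j)%C n =
  (dconv (K := C_Ring) u v n * w n)%C.
Proof.
  intros Hw. unfold dconv.
  change (Cmult ?x (w n)) with (mult (K := C_Ring) x (w n)).
  rewrite <- sum_n_mult_r. apply sum_n_ext. intros i.
  rewrite <- sum_n_mult_r. apply sum_n_ext. intros j.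
  destruct (Nat.eqb_spec (S i * S j) (S n)) as [E|E].
  - rewrite (Hw _ _ _ E). change ((u i * w i) * (v j * w j) = (u i * v j) * (w i * w j))%C.
    ring.
  - symmetry. apply (mult_zero_l (K := C_Ring)).
Qed.

(** * Inverses of Dirichlet series *)

Definition dterm (a : nat -> C) (s : C) (k : nat) : C := (a (S k) * npow_opp (S k) s)%C.

Definition dabs (a : nat -> C) (x : R) (k : nat) : R :=
  Cmod (a (S k)) * exp (- x * ln (INR (S k))).

Lemma Re_opp_mult_RtoC (s : C) (x : R) : Re (- s * RtoC x) = - Re s * x.
Proof. destruct s; simpl; unfold Re; simpl; ring. Qed.

Lemma Cmod_dterm (a : nat -> C) (s : C) (k : nat) :
  Cmod (dterm a s k) = dabs a (Re s) k.
Proof.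
  unfold dterm, dabs, npow_opp. rewrite Cmod_mult, Cmod_Cexp, Re_opp_mult_RtoC. reflexivity.
Qed.

Lemma ln_INR_ge0 (k : nat) : 0 <= ln (INR (S k)).
Proof.
  rewrite <- ln_1. apply ln_le; [lra|]. rewrite S_INR. assert (H := pos_INR k). lra.
Qed.

Lemma ln_INR_ge2 (k : nat) : ln 2 <= ln (INR (S (S k))).
Proof.
  apply ln_le; [lra|]. rewrite !S_INR. assert (H := pos_INR k). lra.
Qed.

Lemma ln2_pos : 0 < ln 2.
Proof. rewrite <- ln_1. apply ln_increasing; lra. Qed.

Lemma exp_le_compat (x y : R) : x <= y -> exp x <= exp y.
Proof. intros [H | ->]; [apply Rlt_le, exp_increasing, H|lra]. Qed.

Lemma npow_opp_mult (i j m : nat) (s : C) :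
  (S i * S j = S m)%nat -> npow_opp (S m) s = (npow_opp (S i) s * npow_opp (S j) s)%C.
Proof.
  intros <-. unfold npow_opp. rewrite <- Cexp_plus, mult_INR, ln_mult, RtoC_plus
    by (apply lt_0_INR; lia).
  f_equal. ring.
Qed.

Lemma npow_opp_1 (s : C) : npow_opp 1 s = RtoC 1.
Proof.
  unfold npow_opp. simpl INR. rewrite ln_1, Cmult_0_r. apply Cexp_0.
Qed.

Lemma dabs_ge0 (a : nat -> C) (x : R) (k : nat) : 0 <= dabs a x k.
Proof. apply Rmult_le_pos; [apply Cmod_ge_0|apply Rlt_le, exp_pos]. Qed.

Lemma dabs_decr (a : nat -> C) (x y : R) (k : nat) : x <= y -> dabs a y k <= dabs a x k.
Proof.
  intros H. apply Rmult_le_compat_l; [apply Cmod_ge_0|]. apply exp_le_compat.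
  assert (L := ln_INR_ge0 k). nra.
Qed.

(** Index [S k] stands for the integer k + 2 >= 2, so moving right by y - x gains at least the
    factor 2^(-(y - x)), uniformly in k. *)
Lemma dabs_tail_decr (a : nat -> C) (x y : R) (k : nat) :
  x <= y -> dabs a y (S k) <= exp (- (y - x) * ln 2) * dabs a x (S k).
Proof.
  intros H. unfold dabs.
  replace (exp (- (y - x) * ln 2) * (Cmod (a (S (S k))) * exp (- x * ln (INR (S (S k))))))
    with (Cmod (a (S (S k))) * (exp (- (y - x) * ln 2) * exp (- x * ln (INR (S (S k))))))
    by ring.
  apply Rmult_le_compat_l; [apply Cmod_ge_0|]. rewrite <- exp_plus. apply exp_le_compat.
  assert (L := ln_INR_ge2 k). nra.
Qed.

(** Telescoping: 1 / (y + 1)^2 <= 1 / y - 1 / (y + 1). *)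
Lemma Rsum_inv_sqr (n : nat) :
  Rsum (fun k => / (INR (S k)) ^ 2) n <= 2 - / INR (S n).
Proof.
  induction n as [|n IH]; [rewrite Rsum_0; simpl; lra|].
  rewrite Rsum_S. rewrite (S_INR (S n)).
  set (y := INR (S n)) in *.
  assert (Hy : 0 < y) by (apply lt_0_INR; lia).
  assert (/ (y + 1) ^ 2 <= / y - / (y + 1)); [|lra].
  replace (/ y - / (y + 1)) with (/ (y * (y + 1))) by (field; lra).
  apply Rinv_le_contravar; nra.
Qed.

(* Bounded terms at [x] become [O(1 / k^2)] at [x + 2]. *)
Lemma dabs_summable (a : nat -> C) (x : R) (l : C) :
  is_dirichlet_series a (RtoC x) l ->
  exists B, forall n, Rsum (dabs a (x + 2)) n <= B.
Proof.
  intros H. destruct (is_Cseries_terms_bounded _ _ H) as [K HK].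
  exists (K * 2). intros n.
  assert (K0 : 0 <= K) by (eapply Rle_trans; [apply Cmod_ge_0|apply (HK 0%nat)]).
  apply Rle_trans with (Rsum (fun k => mult (K := R_Ring) K (/ (INR (S k)) ^ 2)) n).
  - apply Rsum_le. intros k. change (dabs a (x + 2) k <= K * / (INR (S k)) ^ 2).
    specialize (HK k). change (Cmod (dterm a (RtoC x) k) <= K) in HK.
    rewrite Cmod_dterm in HK. simpl Re in HK.
    replace (dabs a (x + 2) k) with (dabs a x k * / INR (S k) ^ 2).
    + apply Rmult_le_compat_r; [|exact HK].
      apply Rlt_le, Rinv_0_lt_compat, pow_lt, lt_0_INR; lia.
    + unfold dabs. rewrite Rmult_assoc. f_equal.
      replace (- (x + 2) * ln (INR (S k))) with
        (- x * ln (INR (S k)) + - (ln (INR (S k)) + ln (INR (S k)))) by ring.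
      rewrite exp_plus, exp_Ropp, exp_plus, exp_ln by (apply lt_0_INR; lia).
      f_equal. f_equal. ring.
  - rewrite sum_n_mult_l. apply Rmult_le_compat_l; [exact K0|].
    assert (A := Rsum_inv_sqr n).
    assert (0 < / INR (S n)) by (apply Rinv_0_lt_compat, lt_0_INR; lia). lra.
Qed.

Lemma exists_small_exp (B e : R) : 0 < e -> exists t, 0 <= t /\ exp (- t * ln 2) * B <= e.
Proof.
  intros He. assert (L := ln2_pos).
  (* Makes t ln 2 = q with q = |B| / e, after which exp q >= 1 + q suffices. *)
  set (t := Rabs B / e / ln 2).
  assert (Ht : t * ln 2 = Rabs B / e) by (unfold t; field; lra).
  assert (HB := Rabs_pos B).
  assert (Hq : 0 <= Rabs B / e) by (apply Rdiv_le_0_compat; lra).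
  exists t. split.
  - apply Rdiv_le_0_compat; [exact Hq|exact L].
  - replace (- t * ln 2) with (- (t * ln 2)) by ring. rewrite Ht, exp_Ropp.
    assert (H1 := exp_ineq1_le (Rabs B / e)).
    assert (H2 := exp_pos (Rabs B / e)).
    apply Rmult_le_reg_l with (1 := H2). rewrite <- Rmult_assoc, Rinv_r, Rmult_1_l by lra.
    apply Rle_trans with (Rabs B); [apply Rle_abs|].
    apply Rle_trans with (Rabs B / e * e); [apply Req_le; field; lra|].
    apply Rmult_le_compat_r; lra.
Qed.

Lemma dterm_tail_le (a : nat -> C) (x B t : R) (s : C) :
  (forall n, Rsum (dabs a x) n <= B) -> 0 <= t -> x + t <= Re s ->
  forall n, Rsum (fun i => Cmod (tail1 (K := C_Ring) (dterm a s) i)) n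
            <= exp (- t * ln 2) * B.
Proof.
  intros HB Ht Hs n.
  apply Rle_trans with (Rsum (fun k => mult (K := R_Ring) (exp (- t * ln 2)) (dabs a x k)) n).
  - apply Rsum_le. intros [|k].
    + simpl tail1. change (Cmod 0 <= exp (- t * ln 2) * dabs a x 0). rewrite Cmod_0.
      apply Rmult_le_pos; [apply Rlt_le, exp_pos|apply dabs_ge0].
    + simpl tail1. rewrite Cmod_dterm.
      apply Rle_trans with (dabs a (x + t) (S k)); [apply dabs_decr; lra|].
      eapply Rle_trans; [apply (dabs_tail_decr a x (x + t)); lra|].
      replace (x + t - x) with t by ring. apply Rle_refl.
  - rewrite sum_n_mult_l. apply Rmult_le_compat_l; [apply Rlt_le, exp_pos|apply HB].
Qed.

Lemma Cmod_sum_le_head_tail (u : nat -> C) (n : nat) :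
  Rsum (fun i => Cmod (u i)) n <=
  Cmod (u O) + Rsum (fun i => Cmod (tail1 (K := C_Ring) u i)) n.
Proof.
  induction n as [|n IH].
  - rewrite !Rsum_0. simpl tail1. change (Cmod (u O) <= Cmod (u O) + Cmod 0).
    rewrite Cmod_0. lra.
  - rewrite !Rsum_S. simpl tail1. lra.
Qed.

Lemma Hinf_inv (f : C -> C) :
  Hinf f -> bounded_below_on_C0 f -> Hinf (fun s => / f s)%C.
Proof.
  intros [[a [sigma [Hsigma Ha]]] [Hhol Hbd]] [delta [Hdelta Hbelow]].
  assert (Hnz : forall s, C0 s -> f s <> RtoC 0).
  { intros s Hs E. specialize (Hbelow s Hs). rewrite E, Cmod_0 in Hbelow. lra. }
  split; [|split].
  - destruct (dabs_summable a (sigma + 1) (f (RtoC (sigma + 1)))) as [B HB].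
    { apply Ha. simpl. lra. }
    (* The quarter serves twice: it leaves |a_1| >= 3 delta / 4, and it is less than half of that
       bound, as the absorption argument requires. *)
    destruct (exists_small_exp B (delta / 4)) as [t [Ht HtB]]; [lra|].
    (* The 1 goes strictly inside the half-plane of convergence, the 2 passes to absolute
       convergence. *)
    set (x := sigma + 1 + 2) in *.
    set (al := fun k => a (S k)).
    assert (Htail : forall s, x + t <= Re s -> forall n,
        Rsum (fun i => Cmod (tail1 (K := C_Ring) (dterm a s) i)) n <= delta / 4).
    { intros s Hs n. eapply Rle_trans; [apply (dterm_tail_le a x B t); auto|exact HtB]. }
    assert (H0 : forall s, dterm a s 0 = a 1%nat).
    { intros s. unfold dterm. rewrite npow_opp_1. ring. }
    assert (Hsum : forall s, x + t <= Re s -> forall n,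
        Rsum (fun i => Cmod (dterm a s i)) n <= Cmod (a 1%nat) + delta / 4).
    { intros s Hs n. eapply Rle_trans; [apply Cmod_sum_le_head_tail|].
      rewrite H0. specialize (Htail s Hs n). lra. }
    (* Evaluation at the single real point x + t replaces the limit Re s -> infinity; the tail there
       costs delta / 4. *)
    assert (Ha1 : 3 * delta / 4 <= Cmod (a 1%nat)).
    { set (s := RtoC (x + t)). assert (Hs : x + t <= Re s) by (simpl; lra).
      assert (Hb := Hbelow s ltac:(unfold C0; simpl; unfold x; lra)).
      enough (Cmod (f s) <= Cmod (a 1%nat) + delta / 4) by lra.
      apply (is_Cseries_bound (dterm a s)).
      - apply Ha. simpl. unfold x. lra.
      - intros n. eapply Rle_trans; [apply Cmod_Csum_le|]. apply Hsum, Hs. }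
    (* Coefficients of a Dirichlet series start at 1 and [dinv] starts at 0, hence [pred]. *)
    exists (fun n => dinv al (pred n)), (x + t). split; [unfold x; lra|].
    intros s Hs. set (v := dterm (fun n => dinv al (pred n)) s).
    assert (Hconv : forall n, dconv (K := C_Ring) (dterm a s) v n = dunit n).
    { intros n.
      transitivity (dconv (K := C_Ring) al (dinv al) n * npow_opp (S n) s)%C.
      - apply (dconv_twist (fun k => npow_opp (S k) s) al (dinv al)).
        intros i j m. apply npow_opp_mult.
      - rewrite dconv_dinv.
        + destruct n as [|n].
          * change (RtoC 1 * npow_opp 1 s = RtoC 1)%C. rewrite npow_opp_1. ring.
          * change (RtoC 0 * npow_opp (S (S n)) s = RtoC 0)%C. ring.
        + apply Cmod_gt_0. unfold al. lra. }
    assert (Hvsum : forall n, Rsum (fun i => Cmod (v i)) n <= 2 / (3 * delta / 4)).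
    { apply (dconv_inverse_summable (dterm a s)); [lra| | |exact Hconv].
      - rewrite H0. exact Ha1.
      - intros n. eapply Rle_trans; [apply Htail; lra|]. lra. }
    destruct (ex_Cseries_bounded v _ Hvsum) as [l Hl].
    assert (E : (f s * l)%C = RtoC 1).
    { apply (Cseries_prod_of_dconv_one (dterm a s) v _ _ (f s) l
        (Hsum s ltac:(lra)) Hvsum Hconv); [|exact Hl].
      apply Ha. unfold x in Hs. lra. }
    assert (Hs0 : C0 s) by (unfold C0, x in *; lra).
    replace (/ f s)%C with l; [exact Hl|].
    specialize (Hnz s Hs0).
    assert (A : forall y z : C, y <> RtoC 0 -> (y * z = 1 -> z = / y)%C).
    { intros y z Hy Hyz. transitivity (/ y * (y * z))%C; [field; exact Hy|].
      rewrite Hyz. ring. }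
    exact (A _ _ Hnz E).
  - intros s Hs. destruct (Hhol s Hs) as [l Hl].
    eexists. apply (Cderiv_comp Cinv f); [apply Cderiv_inv, Hnz, Hs|exact Hl].
  - exists (/ delta). intros s Hs. specialize (Hbelow s Hs). rewrite Cmod_inv by auto.
    apply Rinv_le_contravar; assumption.
Qed.

Lemma Hinf_invertible_iff (f : C -> C) :
  Hinf f -> (Hinf_invertible f <-> bounded_below_on_C0 f).
Proof.
  intros Hf. split.
  - intros [g [[_ [_ [M HM]]] Hg]].
    assert (HM' : 0 < Rmax M 1) by (eapply Rlt_le_trans; [|apply Rmax_r]; lra).
    exists (/ Rmax M 1). split; [apply Rinv_0_lt_compat; exact HM'|].
    intros s Hs. assert (E := f_equal Cmod (Hg s Hs)). rewrite Cmod_mult, Cmod_1 in E.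
    specialize (HM s Hs). assert (Hm := Rmax_l M 1). assert (Hf0 := Cmod_ge_0 (f s)).
    apply Rmult_le_reg_r with (1 := HM'). rewrite Rinv_l by lra. nra.
  - intros Hb. exists (fun s => / f s)%C. split; [apply Hinf_inv; assumption|].
    intros s Hs. apply Cinv_r. intros E. destruct Hb as [d [Hd Hb]].
    specialize (Hb s Hs). rewrite E, Cmod_0 in Hb. lra.
Qed.

(** Integrals are taken over [C] as a real vector space, so a complex factor is handled through the
    coordinates, by four real integrals. *)
Lemma is_CInt_scal (c : C) (u : R -> C) (a b : R) (l : C) :
  is_CInt u a b l -> is_CInt (fun t => c * u t)%C a b (c * l)%C.
Proof.
  intros H.
  assert (H1 := is_RInt_fct_extend_fst (U := R_NormedModule) (V := R_NormedModule) u a b l H).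
  assert (H2 := is_RInt_fct_extend_snd (U := R_NormedModule) (V := R_NormedModule) u a b l H).
  apply (is_RInt_fct_extend_pair (U := R_NormedModule) (V := R_NormedModule)).
  - apply (is_RInt_minus (V := R_NormedModule) (fun t => fst c * fst (u t)) (fun t => snd c * snd (u t)));
      apply (is_RInt_scal (V := R_NormedModule)); assumption.
  - apply (is_RInt_plus (V := R_NormedModule) (fun t => fst c * snd (u t)) (fun t => snd c * fst (u t)));
      apply (is_RInt_scal (V := R_NormedModule)); assumption.
Qed.

(** * Mean values on the real line *)

(** The limit of (1 / 2T) times the integral over [-T, T], with denominators cleared. The
    existential over [I] includes integrability for large T. *)
Definition is_mean (u : R -> C) (l : C) : Prop :=
  forall eps, 0 < eps -> exists T0, 0 < T0 /\ forall T, T0 <= T ->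
    exists I, is_CInt u (- T) T I /\ Cmod (I - RtoC (2 * T) * l) <= eps * (2 * T).

Lemma is_mean_ext (u v : R -> C) (l : C) :
  (forall t, u t = v t) -> is_mean u l -> is_mean v l.
Proof.
  intros E H eps Heps. destruct (H eps Heps) as [T0 [H0 H1]].
  exists T0; split; [exact H0|]. intros T HT. destruct (H1 T HT) as [I [H2 H3]].
  exists I; split; [|exact H3]. eapply is_RInt_ext; [|exact H2]. intros; apply E.
Qed.

Lemma is_mean_plus (u v : R -> C) (k l : C) :
  is_mean u k -> is_mean v l -> is_mean (fun t => u t + v t)%C (k + l)%C.
Proof.
  intros Hu Hv eps Heps.
  destruct (Hu (eps / 2)) as [T1 [P1 H1]]; [lra|].
  destruct (Hv (eps / 2)) as [T2 [P2 H2]]; [lra|].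
  exists (Rmax T1 T2). split; [eapply Rlt_le_trans; [exact P1|apply Rmax_l]|].
  intros T HT. assert (M1 := Rmax_l T1 T2). assert (M2 := Rmax_r T1 T2).
  destruct (H1 T) as [I [I1 I2]]; [lra|]. destruct (H2 T) as [J [J1 J2]]; [lra|].
  exists (I + J)%C. split; [apply is_CInt_plus; assumption|].
  replace (I + J - RtoC (2 * T) * (k + l))%C with
    ((I - RtoC (2 * T) * k) + (J - RtoC (2 * T) * l))%C by ring.
  eapply Rle_trans; [apply Cmod_triangle|]. lra.
Qed.

Lemma is_mean_scal (c : C) (u : R -> C) (l : C) :
  is_mean u l -> is_mean (fun t => c * u t)%C (c * l)%C.
Proof.
  intros Hu eps Heps. assert (Hc := Cmod_ge_0 c).
  destruct (Hu (eps / (1 + Cmod c))) as [T0 [P H]]; [apply Rdiv_lt_0_compat; lra|].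
  exists T0. split; [exact P|]. intros T HT. destruct (H T HT) as [I [I1 I2]].
  exists (c * I)%C. split; [apply is_CInt_scal; assumption|].
  replace (c * I - RtoC (2 * T) * (c * l))%C with (c * (I - RtoC (2 * T) * l))%C by ring.
  rewrite Cmod_mult.
  apply Rle_trans with ((1 + Cmod c) * (eps / (1 + Cmod c) * (2 * T))).
  - apply Rmult_le_compat; [exact Hc|apply Cmod_ge_0|lra|exact I2].
  - apply Req_le. field. lra.
Qed.

Lemma is_mean_unique (u : R -> C) (k l : C) : is_mean u k -> is_mean u l -> k = l.
Proof.
  intros Hk Hl. apply Ceq_minus, Cmod_eq_0, Rle_antisym; [|apply Cmod_ge_0].
  apply Rnot_lt_le. intros H. set (d := Cmod (k - l)) in *.
  destruct (Hk (d / 4)) as [T1 [P1 H1]]; [lra|].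
  destruct (Hl (d / 4)) as [T2 [P2 H2]]; [lra|].
  set (T := Rmax T1 T2). assert (M1 := Rmax_l T1 T2). assert (M2 := Rmax_r T1 T2).
  destruct (H1 T M1) as [I [I1 I2]]. destruct (H2 T M2) as [J [J1 J2]].
  apply (is_RInt_unique (V := C_R_CompleteNormedModule)) in I1.
  apply (is_RInt_unique (V := C_R_CompleteNormedModule)) in J1.
  assert (E : J = I) by congruence. rewrite E in J2.
  assert (T0 : 0 < T) by (unfold T; lra).
  assert (A := Cmod_triangle (- (I - RtoC (2 * T) * k)) (I - RtoC (2 * T) * l)).
  replace (- (I - RtoC (2 * T) * k) + (I - RtoC (2 * T) * l))%C
    with (RtoC (2 * T) * (k - l))%C in A by ring.
  rewrite Cmod_opp, Cmod_mult, Cmod_R, Rabs_pos_eq in A by lra.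
  change (Cmod (k - l)) with d in A. nra.
Qed.

(** Means pass to uniform limits. All approximants in use have the same mean [l], which removes any
    need for convergence of their means. *)
Lemma is_mean_approx (u : R -> C) (l : C) :
  (forall T, 0 < T -> ex_CInt u (- T) T) ->
  (forall eps, 0 < eps -> exists v, is_mean v l /\ forall t, Cmod (u t - v t) <= eps) ->
  is_mean u l.
Proof.
  intros Hex H eps Heps. destruct (H (eps / 2)) as [v [Hv Huv]]; [lra|].
  destruct (Hv (eps / 2)) as [T0 [P0 H0]]; [lra|].
  exists T0. split; [exact P0|]. intros T HT. destruct (H0 T HT) as [J [J1 J2]].
  assert (HI := CInt_correct _ _ _ (Hex T ltac:(lra))).
  set (I := CInt u (- T) T) in *.
  exists I. split; [exact HI|].
  assert (A : Cmod (I - J) <= (T - - T) * (eps / 2)).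
  { apply (CInt_norm_le0 (fun t => u t - v t)%C); [lra|auto|].
    apply is_CInt_minus; assumption. }
  replace (I - RtoC (2 * T) * l)%C with ((I - J) + (J - RtoC (2 * T) * l))%C by ring.
  eapply Rle_trans; [apply Cmod_triangle|]. lra.
Qed.

Lemma is_mean_const (c : C) : is_mean (fun _ => c) c.
Proof.
  intros eps Heps. exists 1. split; [lra|]. intros T HT.
  exists (RtoC (T - - T) * c)%C. split; [apply is_CInt_const|].
  replace (T - - T) with (2 * T) by ring.
  replace (RtoC (2 * T) * c - RtoC (2 * T) * c)%C with (RtoC 0) by ring.
  rewrite Cmod_0. nra.
Qed.

Lemma is_CInt_Cexp_imag (mu a b : R) :
  mu <> 0 ->
  is_CInt (fun t => Cexp (0, mu * t)) a b
    ((sin (mu * b) - sin (mu * a)) / mu, (cos (mu * a) - cos (mu * b)) / mu).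
Proof.
  intros Hmu.
  apply (is_RInt_fct_extend_pair (U := R_NormedModule) (V := R_NormedModule)); simpl.
  - replace ((sin (mu * b) - sin (mu * a)) / mu)
      with (minus (sin (mu * b) / mu) (sin (mu * a) / mu))
      by (unfold minus, plus, opp; simpl; field; exact Hmu).
    apply (is_RInt_derive (V := R_CompleteNormedModule) (fun t => sin (mu * t) / mu)).
    + intros t _. auto_derive; [auto|]. rewrite exp_0. field. exact Hmu.
    + intros t _. apply (ex_derive_continuous (V := R_NormedModule)). auto_derive. auto.
  - replace ((cos (mu * a) - cos (mu * b)) / mu)
      with (minus (- cos (mu * b) / mu) (- cos (mu * a) / mu))
      by (unfold minus, plus, opp; simpl; field; exact Hmu).
    apply (is_RInt_derive (V := R_CompleteNormedModule) (fun t => - cos (mu * t) / mu)).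
    + intros t _. auto_derive; [auto|]. rewrite exp_0. field. exact Hmu.
    + intros t _. apply (ex_derive_continuous (V := R_NormedModule)). auto_derive. auto.
Qed.

Lemma is_mean_Cexp_imag (mu : R) :
  mu <> 0 -> is_mean (fun t => Cexp (0, mu * t)) (RtoC 0).
Proof.
  intros Hmu eps Heps.
  assert (Hp : 0 < Rabs mu) by (apply Rabs_pos_lt; exact Hmu).
  (* The integral over [-T, T] is bounded by 4 / |mu| independently of T, and this is at most 2 T
     eps from here on. *)
  exists (2 / Rabs mu / eps). split.
  { apply Rdiv_lt_0_compat; [apply Rdiv_lt_0_compat|]; lra. }
  intros T HT. eexists. split; [apply is_CInt_Cexp_imag; exact Hmu|].
  assert (Z : forall z : C, (z - RtoC (2 * T) * 0)%C = z) by (intros; ring).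
  rewrite Z.
  eapply Rle_trans; [apply Cmod_le_Rabs|]. simpl. unfold Rdiv. rewrite !Rabs_mult, Rabs_inv.
  assert (B : forall x y, -1 <= x <= 1 -> -1 <= y <= 1 -> Rabs (x - y) <= 2)
    by (intros; apply Rabs_le; lra).
  assert (B1 := B _ _ (SIN_bound (mu * T)) (SIN_bound (mu * - T))).
  assert (B2 := B _ _ (COS_bound (mu * - T)) (COS_bound (mu * T))).
  assert (Hi : 0 < / Rabs mu) by (apply Rinv_0_lt_compat; exact Hp).
  apply Rmult_le_compat_r with (r := eps) in HT; [|lra].
  replace (2 / Rabs mu / eps * eps) with (2 * / Rabs mu) in HT by (field; lra).
  nra.
Qed.

Lemma Cexp_line (mu x t : R) :
  Cexp (RtoC mu * (x, t)) = (RtoC (exp (mu * x)) * Cexp (0%R, (mu * t)%R))%C.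
Proof.
  unfold Cexp, Cmult, RtoC, Re, Im; simpl. rewrite exp_0.
  replace (mu * x - 0 * t) with (mu * x) by ring.
  replace (mu * t + 0 * x) with (mu * t) by ring.
  apply injective_projections; simpl; ring.
Qed.

(** Orthogonality of the characters t -> exp(i mu t); on the line Re s = x they only acquire the
    constant factor exp(mu x). *)
Lemma is_mean_Cexp (mu x : R) :
  is_mean (fun t => Cexp (RtoC mu * (x, t))) (if Req_EM_T mu 0 then RtoC 1 else RtoC 0).
Proof.
  destruct (Req_EM_T mu 0) as [-> | Hmu].
  - apply is_mean_ext with (fun _ => RtoC 1); [|apply is_mean_const].
    intros t. rewrite Cmult_0_l. symmetry. apply Cexp_0.
  - apply is_mean_ext with (fun t => RtoC (exp (mu * x)) * Cexp (0%R, (mu * t)%R))%C.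
    + intros t. symmetry. apply Cexp_line.
    + replace (RtoC 0) with (RtoC (exp (mu * x)) * 0)%C by ring.
      apply is_mean_scal, is_mean_Cexp_imag, Hmu.
Qed.

(** * Coefficients of a bounded Dirichlet series *)

Lemma is_Cseries_tail_le (u : nat -> C) (l : C) (N : nat) (B : R) :
  is_Cseries u l -> (forall n, Rsum (fun k => Cmod (u k)) n <= B) ->
  Cmod (l - Csum u N) <= B - Rsum (fun k => Cmod (u k)) N.
Proof.
  intros H HB.
  assert (Hinc : forall M, (N <= M)%nat ->
    Cmod (Csum u M - Csum u N) <=
    Rsum (fun k => Cmod (u k)) M - Rsum (fun k => Cmod (u k)) N).
  { intros M HM. induction HM as [|M HM IH].
    - set (y := Csum u N). assert (A : forall y : C, (y - y = 0)%C) by (intros; ring).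
      rewrite (A y), Cmod_0. lra.
    - rewrite Csum_S, Rsum_S.
      assert (A : forall x y z : C, (x + y - z = (x - z) + y)%C) by (intros; ring).
      rewrite (A (Csum u M)). eapply Rle_trans; [apply Cmod_triangle|]. lra. }
  apply le_epsilon. intros eps Heps.
  destruct (proj1 (is_Cseries_eps _ _) H eps Heps) as [M HM].
  specialize (HM (N + M)%nat ltac:(lia)). specialize (Hinc (N + M)%nat ltac:(lia)).
  specialize (HB (N + M)%nat).
  assert (A : forall x y z : C, (x - y = (z - y) + - (z - x))%C) by (intros; ring).
  rewrite (A l (Csum u N) (Csum u (N + M))). eapply Rle_trans; [apply Cmod_triangle|].
  rewrite Cmod_opp. lra.
Qed.

(** The part of term [k] that survives in the mean at frequency [lam]. Frequencies are arbitrary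
    reals because values such as k ln 3 - ln 2, not the logarithm of an integer, have to be tested
    as well. *)
Definition freq_coef (a : nat -> C) (lam : R) (k : nat) : C :=
  if Req_EM_T lam (ln (INR (S k))) then a (S k) else RtoC 0.

Lemma Cexp_dterm (a : nat -> C) (lam : R) (s : C) (k : nat) :
  (Cexp (RtoC lam * s) * dterm a s k)%C =
  (a (S k) * Cexp (RtoC (lam - ln (INR (S k))) * s))%C.
Proof.
  unfold dterm, npow_opp. rewrite RtoC_minus.
  replace ((RtoC lam - RtoC (ln (INR (S k)))) * s)%C
    with (RtoC lam * s + - s * RtoC (ln (INR (S k))))%C by ring.
  rewrite Cexp_plus. ring.
Qed.

Lemma is_mean_partial_sum (a : nat -> C) (lam x : R) (N : nat) :
  is_mean (fun t => Cexp (RtoC lam * (x, t)) * Csum (dterm a (x, t)) N)%C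
          (Csum (freq_coef a lam) N).
Proof.
  assert (T : forall k, is_mean (fun t => Cexp (RtoC lam * (x, t)) * dterm a (x, t) k)%C
                                (freq_coef a lam k)).
  { intros k.
    apply is_mean_ext with
      (fun t => a (S k) * Cexp (RtoC (lam - ln (INR (S k))) * (x, t)))%C.
    - intros t. symmetry. apply Cexp_dterm.
    - replace (freq_coef a lam k) with (a (S k) *
        (if Req_EM_T (lam - ln (INR (S k))) 0 then RtoC 1 else RtoC 0))%C.
      + apply is_mean_scal, is_mean_Cexp.
      + unfold freq_coef.
        destruct (Req_EM_T lam _), (Req_EM_T (lam - _) 0); try lra; ring. }
  induction N as [|N IH].
  - rewrite Csum_0. apply is_mean_ext with (2 := T 0%nat).
    intros t. rewrite Csum_0. reflexivity.
  - rewrite Csum_S. apply is_mean_ext with (2 := is_mean_plus _ _ _ _ IH (T (S N))).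
    intros t. rewrite Csum_S.
    assert (A : forall x y z : C, (x * y + x * z = x * (y + z))%C) by (intros; ring).
    apply A.
Qed.

(** Absolute convergence at x makes the series converge uniformly on the vertical line, so the means
    of partial sums pass to [g]. Giving [l] as the eventual value of the sums of [freq_coef] covers
    both a frequency ln n and one that is missed. *)
Lemma is_mean_dirichlet (g : C -> C) (a : nat -> C) (lam x B : R) (l : C) (N0 : nat) :
  (forall t, is_dirichlet_series a (x, t) (g (x, t))) ->
  (forall t, holo_at g (x, t)) ->
  (forall n, Rsum (dabs a x) n <= B) ->
  (forall n, (N0 <= n)%nat -> Csum (freq_coef a lam) n = l) ->
  is_mean (fun t => Cexp (RtoC lam * (x, t)) * g (x, t))%C l.
Proof.
  intros Hg Hhol HB Hl. apply is_mean_approx.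
  - intros T HT. apply (ex_CInt_v (fun s => Cexp (RtoC lam * s) * g s)%C); [lra|].
    intros y _. destruct (Hhol y) as [m Hm].
    eexists. apply Cderiv_mult; [apply Cderiv_Cexp_scal|exact Hm].
  - intros eps Heps.
    assert (Eu := ex_series_bounded _ B (dabs_ge0 a x) HB).
    set (L := Series (dabs a x)).
    assert (Lu : is_lim_seq (Rsum (dabs a x)) L) by exact (Series_correct _ Eu).
    assert (Hex := exp_pos (lam * x)).
    assert (He : 0 < eps / exp (lam * x)) by (apply Rdiv_lt_0_compat; lra).
    apply is_lim_seq_spec in Lu. destruct (Lu (mkposreal _ He)) as [N HN].
    specialize (HN (N0 + N)%nat ltac:(lia)). simpl in HN. apply Rabs_lt_between in HN.
    exists (fun t => Cexp (RtoC lam * (x, t)) * Csum (dterm a (x, t)) (N0 + N))%C. split.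
    + rewrite <- (Hl (N0 + N)%nat) by lia. apply is_mean_partial_sum.
    + intros t.
      assert (Hd : forall n, Rsum (fun k => Cmod (dterm a (x, t) k)) n = Rsum (dabs a x) n)
        by (intros n; apply sum_n_ext; intros k; apply Cmod_dterm).
      assert (A := is_Cseries_tail_le (dterm a (x, t)) (g (x, t)) (N0 + N) L (Hg t)
        (fun n => eq_ind_r (fun y => y <= L) (Rsum_le_Series _ n (dabs_ge0 a x) Eu) (Hd n))).
      rewrite Hd in A.
      assert (D : forall x y z : C, (x * y - x * z = x * (y - z))%C) by (intros; ring).
      rewrite (D _ (g (x, t)) (Csum (dterm a (x, t)) (N0 + N))).
      rewrite Cmod_mult, Cmod_Cexp.
      replace (Re (RtoC lam * (x, t))) with (lam * x) by (unfold Re; simpl; ring).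
      apply Rle_trans with (exp (lam * x) * (eps / exp (lam * x))).
      * apply Rmult_le_compat_l; lra.
      * apply Req_le. field. lra.
Qed.

Lemma Csum_freq_coef_hit (a : nat -> C) (m n : nat) :
  (m <= n)%nat -> Csum (freq_coef a (ln (INR (S m)))) n = a (S m).
Proof.
  intros H. rewrite (sum_n_single (G := C_Ring) _ n m H); unfold freq_coef.
  - destruct (Req_EM_T _ _); congruence.
  - intros k Hk. destruct (Req_EM_T _ _) as [E|E]; [|reflexivity].
    apply ln_inv in E; try (apply lt_0_INR; lia). apply INR_eq in E. congruence.
Qed.

Lemma Csum_freq_coef_miss (a : nat -> C) (lam : R) (n : nat) :
  (forall k, lam <> ln (INR (S k))) -> Csum (freq_coef a lam) n = RtoC 0.
Proof.
  intros H. apply (sum_n_zero (G := C_Ring)). intros k _. unfold freq_coef.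
  destruct (Req_EM_T _ _) as [E|E]; [destruct (H k E)|reflexivity].
Qed.

(* Cauchy's theorem moves the line of integration from [x1] to [x0]; the horizontal
   sides stay bounded and disappear after division by [2 T]. *)
Lemma mean_bound_shift (g : C -> C) (lam x0 x1 M : R) (l : C) :
  holomorphic_on_C0 g -> (forall s, C0 s -> Cmod (g s) <= M) -> 0 < x0 <= x1 ->
  is_mean (fun t => Cexp (RtoC lam * (x1, t)) * g (x1, t))%C l ->
  Cmod l <= M * exp (lam * x0).
Proof.
  intros Hhol HM Hx Hl.
  assert (M0 : 0 <= M).
  { eapply Rle_trans; [apply Cmod_ge_0|apply (HM (x0, 0))]. unfold C0; simpl; lra. }
  set (h := fun s => (Cexp (RtoC lam * s) * g s)%C).
  assert (Hh : forall x t, 0 < x -> holo_at h (x, t)).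
  { intros x t H. destruct (Hhol (x, t)) as [m Hm]; [exact H|].
    eexists. apply Cderiv_mult; [apply Cderiv_Cexp_scal|exact Hm]. }
  assert (Hmod : forall x t, 0 < x -> Cmod (h (x, t)) <= M * exp (lam * x)).
  { intros x t H. unfold h. rewrite Cmod_mult, Cmod_Cexp, Rmult_comm.
    replace (Re (RtoC lam * (x, t))) with (lam * x) by (unfold Re; simpl; ring).
    apply Rmult_le_compat_r; [apply Rlt_le, exp_pos|]. apply HM. exact H. }
  (* A bound for the whole strip, and thus for the horizontal sides at any height; |lam| makes it
     valid for either sign of [lam]. *)
  set (K := M * exp (Rabs lam * x1)).
  assert (HK : forall x t, x0 <= x <= x1 -> Cmod (h (x, t)) <= K).
  { intros x t H. eapply Rle_trans; [apply Hmod; lra|].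
    apply Rmult_le_compat_l; [exact M0|]. apply exp_le_compat.
    apply Rle_trans with (Rabs lam * x).
    - apply Rmult_le_compat_r; [lra|apply Rle_abs].
    - apply Rmult_le_compat_l; [apply Rabs_pos|lra]. }
  assert (K0 : 0 <= K) by (apply Rmult_le_pos; [exact M0|apply Rlt_le, exp_pos]).
  apply le_epsilon. intros eps Heps.
  destruct (Hl (eps / 2)) as [T0 [P0 H0]]; [lra|].
  (* Both horizontal sides together contribute at most T eps, half of the allowance 2 T eps; the
     error in the mean uses the other half. *)
  set (T := T0 + 2 * (x1 - x0) * K / eps).
  assert (HT : T0 <= T).
  { unfold T. assert (0 <= 2 * (x1 - x0) * K / eps); [|lra].
    apply Rdiv_le_0_compat; [|exact Heps].
    apply Rmult_le_pos; [lra|exact K0]. }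
  assert (HTe : 2 * (x1 - x0) * K <= T * eps).
  { unfold T. rewrite Rmult_plus_distr_r.
    replace (2 * (x1 - x0) * K / eps * eps) with (2 * (x1 - x0) * K) by (field; lra). nra. }
  destruct (H0 T HT) as [I [I1 I2]].
  assert (G := goursat h x0 x1 (- T) T ltac:(lra) ltac:(lra)
                 (fun x y H _ => Hh x y ltac:(lra))).
  unfold rect_int in G.
  rewrite (is_RInt_unique (V := C_R_CompleteNormedModule) (fun t => h (x1, t)) _ _ _ I1) in G.
  assert (D : forall y, is_CInt (fun x => h (x, y)) x0 x1 (CInt (fun x => h (x, y)) x0 x1)).
  { intros y. apply CInt_correct, ex_CInt_h; [lra|]. intros; apply Hh; lra. }
  assert (D0 : is_CInt (fun t => h (x0, t)) (- T) T (CInt (fun t => h (x0, t)) (- T) T)).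
  { apply CInt_correct, ex_CInt_v; [lra|]. intros; apply Hh; lra. }
  assert (B1 := CInt_norm_le0 _ _ _ K _ (proj2 Hx) (fun x H => HK x (- T) H) (D (- T))).
  assert (B2 := CInt_norm_le0 _ _ _ K _ (proj2 Hx) (fun x H => HK x T H) (D T)).
  assert (B3 := CInt_norm_le0 _ (- T) T (M * exp (lam * x0)) _ ltac:(lra)
    (fun t _ => Hmod x0 t (proj1 Hx)) D0).
  set (u := CInt (fun x => h (x, (- T)%R)) x0 x1) in *.
  set (v := CInt (fun x => h (x, T)) x0 x1) in *.
  set (w := CInt (fun t => h (x0, t)) (- T) T) in *.
  assert (E : I = (w + Ci * (u + - v))%C).
  { assert (A : forall u v I w : C, (u - v + Ci * (I - w) = 0 -> I = w + Ci * (u + - v))%C).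
    { intros u' v' I' w' H'.
      transitivity (w' + Ci * (u' + - v') - Ci * (u' - v' + Ci * (I' - w')))%C;
        [|rewrite H'; ring].
      replace (Ci * (u' - v' + Ci * (I' - w')))%C
        with (Ci * (u' - v') + Ci * Ci * (I' - w'))%C by ring.
      replace (Ci * Ci)%C with (- (1))%C
        by (apply injective_projections; simpl; ring). ring. }
    exact (A u v I w G). }
  assert (A1 : Cmod I <= Cmod w + (Cmod u + Cmod v)).
  { rewrite E. eapply Rle_trans; [apply Cmod_triangle|]. apply Rplus_le_compat_l.
    rewrite Cmod_mult, Cmod_Ci, Rmult_1_l. eapply Rle_trans; [apply Cmod_triangle|].
    rewrite Cmod_opp. lra. }
  assert (A2 := Cmod_triangle I (- (I - RtoC (2 * T) * l))).
  replace (I + - (I - RtoC (2 * T) * l))%C with (RtoC (2 * T) * l)%C in A2 by ring.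
  rewrite Cmod_opp, Cmod_mult, Cmod_R, Rabs_pos_eq in A2 by lra.
  apply Rmult_le_reg_l with (2 * T); [lra|]. lra.
Qed.

(** * Failure of the corona property *)

Lemma npow_opp_Cexp (n : nat) (s : C) :
  npow_opp n s = Cexp (RtoC (- ln (INR n)) * s).
Proof. unfold npow_opp. f_equal. rewrite RtoC_opp. ring. Qed.

Lemma Cmod_npow_opp (n : nat) (s : C) :
  Cmod (npow_opp n s) = exp (- (Re s * ln (INR n))).
Proof.
  unfold npow_opp. rewrite Cmod_Cexp, Re_opp_mult_RtoC. f_equal. ring.
Qed.

Lemma Hinf_scal_npow (c : C) (m : nat) : Hinf (fun s => c * npow_opp (S m) s)%C.
Proof.
  split; [|split].
  - exists (fun n => if (n =? S m)%nat then c else RtoC 0), 0. split; [lra|].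
    intros s _. apply is_Cseries_eps. intros eps Heps. exists m. intros n Hn.
    rewrite (sum_n_single (G := C_Ring) _ n m Hn).
    + rewrite Nat.eqb_refl.
      replace (c * npow_opp (S m) s - c * npow_opp (S m) s)%C with (RtoC 0) by ring.
      rewrite Cmod_0. exact Heps.
    + intros k Hk. destruct (Nat.eqb_spec (S k) (S m)); [lia|].
      apply (mult_zero_l (K := C_Ring)).
  - intros s _. eexists. apply (Cderiv_mult (fun _ => c)); [apply Cderiv_const|].
    eapply Cderiv_ext; [|reflexivity|apply Cderiv_Cexp_scal].
    intros w. symmetry. apply npow_opp_Cexp.
  - exists (Cmod c). intros s Hs. rewrite Cmod_mult, Cmod_npow_opp.
    rewrite <- (Rmult_1_r (Cmod c)) at 2. apply Rmult_le_compat_l; [apply Cmod_ge_0|].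
    rewrite <- exp_0. apply exp_le_compat. assert (L := ln_INR_ge0 m). unfold C0 in Hs. nra.
Qed.

Lemma Hinf_plus (f g : C -> C) : Hinf f -> Hinf g -> Hinf (fun s => f s + g s)%C.
Proof.
  intros [[a [x [Hx Ha]]] [Hf [M HM]]] [[b [y [Hy Hb]]] [Hg [N HN]]].
  split; [|split].
  - exists (fun n => a n + b n)%C, (Rmax x y).
    split; [eapply Rle_trans; [exact Hx|apply Rmax_l]|].
    intros s Hs. assert (M1 := Rmax_l x y). assert (M2 := Rmax_r x y).
    eapply is_series_ext;
      [|apply (is_series_plus (V := C_NormedModule) _ _ _ _ (Ha s ltac:(lra)) (Hb s ltac:(lra)))].
    intros n. symmetry. apply (Cmult_plus_distr_r (a (S n)) (b (S n))).
  - intros s Hs. destruct (Hf s Hs) as [l Hl]. destruct (Hg s Hs) as [m Hm].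
    eexists. apply Cderiv_plus; [exact Hl|exact Hm].
  - exists (M + N). intros s Hs. eapply Rle_trans; [apply Cmod_triangle|].
    apply Rplus_le_compat; auto.
Qed.

(** * Coefficients at powers of 3, and the counterexample *)

Lemma ln3_pow (k : nat) : INR k * ln 3 = ln (INR (3 ^ k)).
Proof. rewrite pow_INR, ln_pow by (simpl; lra). do 2 f_equal. simpl; lra. Qed.

Lemma INR_3 : INR 3 = 3.
Proof. simpl; lra. Qed.

Lemma odd_pow3 (k : nat) : Nat.odd (3 ^ k) = true.
Proof.
  induction k as [|k IH]; [reflexivity|]. rewrite Nat.pow_succ_r', Nat.odd_mul, IH. reflexivity.
Qed.

Lemma pow3_pos (k : nat) : (0 < 3 ^ k)%nat.
Proof. assert (3 ^ k <> 0)%nat by (apply Nat.pow_nonzero; lia). lia. Qed.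

Lemma ln3_pos : 0 < ln 3.
Proof. rewrite <- ln_1. apply ln_increasing; lra. Qed.

(** A factor n^(-s) lowers the frequency by ln n: the mean of n^(-s) g(s) at [lam] is that of g at
    lam - ln n. *)
Lemma Cexp_shift (lam : R) (n : nat) (s : C) :
  Cexp (RtoC (lam - ln (INR n)) * s) = (Cexp (RtoC lam * s) * npow_opp n s)%C.
Proof.
  rewrite npow_opp_Cexp, <- Cexp_plus. f_equal. rewrite RtoC_minus, RtoC_opp. ring.
Qed.

Lemma Csum_freq_coef_pow3 (b : nat -> C) (k n : nat) :
  (3 ^ k <= n)%nat -> Csum (freq_coef b (INR k * ln 3)) n = b (3 ^ k)%nat.
Proof.
  intros H. rewrite ln3_pow. assert (P := pow3_pos k).
  destruct (3 ^ k)%nat as [|m]; [lia|]. apply Csum_freq_coef_hit. lia.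
Qed.

(** The factors 1 and [npow_opp 1 s] give both functions the shape of sums of monomials, so that
    [Hinf_scal_npow] and [Hinf_plus] apply as they stand. *)
Definition corona1 (s : C) : C := (RtoC 1 * npow_opp 2 s)%C.
Definition corona2 (s : C) : C := (RtoC 1 * npow_opp 3 s + RtoC (- / 9) * npow_opp 1 s)%C.

Lemma corona_bounded_below (s : C) :
  C0 s -> / 16 <= Cmod (corona1 s) + Cmod (corona2 s).
Proof.
  intros Hs. unfold corona1, corona2. rewrite npow_opp_1, !Cmult_1_l, Cmult_1_r.
  rewrite Cmod_npow_opp. simpl INR. replace (1 + 1) with 2 by lra.
  assert (P2 := Cmod_ge_0 (npow_opp 3 s + RtoC (- / 9))).
  assert (P1 := exp_pos (- (Re s * ln 2))).
  (* For Re s <= 4 the first function alone has modulus at least 2^(-4) = 1/16. Beyond, |3^(-s)| <=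
     1/81, and the second has modulus at least 1/9 - 1/81 = 8/81 > 1/16. *)
  destruct (Rle_lt_dec (Re s) 4) as [H|H].
  - assert (E : exp (- (4 * ln 2)) = / 16).
    { rewrite exp_Ropp. f_equal. replace (4 * ln 2) with (INR 4 * ln 2) by (simpl; lra).
      rewrite <- ln_pow by lra. rewrite exp_ln; lra. }
    assert (exp (- (4 * ln 2)) <= exp (- (Re s * ln 2))); [|lra].
    apply exp_le_compat. assert (L := ln2_pos). nra.
  - assert (E : exp (- (4 * ln 3)) = / 81).
    { rewrite exp_Ropp. f_equal. replace (4 * ln 3) with (INR 4 * ln 3) by (simpl; lra).
      rewrite <- ln_pow by lra. rewrite exp_ln; lra. }
    assert (H3 : Cmod (npow_opp 3 s) <= / 81).
    { rewrite Cmod_npow_opp, INR_3, <- E. apply exp_le_compat.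
      assert (0 < ln 3) by (rewrite <- ln_1; apply ln_increasing; lra). nra. }
    assert (T := Cmod_triangle (- (npow_opp 3 s + RtoC (- / 9))) (npow_opp 3 s)).
    replace (- (npow_opp 3 s + RtoC (- / 9)) + npow_opp 3 s)%C with (RtoC (/ 9)) in T
      by (rewrite RtoC_opp; ring).
    rewrite Cmod_opp, Cmod_R, Rabs_pos_eq in T by lra. lra.
Qed.

Lemma corona_no_bezout (g1 g2 : C -> C) :
  Hinf g1 -> Hinf g2 ->
  ~ (forall s, C0 s -> (corona1 s * g1 s + corona2 s * g2 s)%C = RtoC 1).
Proof.
  intros [[a [sa [Hsa Ha]]] [Hg1 _]] [[b [sb [Hsb Hb]]] [Hg2 [M HM]]] H.
  set (y := Rmax sa sb + 1). assert (Hma := Rmax_l sa sb). assert (Hmb := Rmax_r sa sb).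
  destruct (dabs_summable a y _ (Ha (RtoC y) ltac:(simpl; unfold y; lra))) as [A HA].
  destruct (dabs_summable b y _ (Hb (RtoC y) ltac:(simpl; unfold y; lra))) as [B HB].
  set (x := y + 2) in *. assert (Hx : 1 <= x) by (unfold x, y; lra).
  assert (Ha' : forall t, is_dirichlet_series a (x, t) (g1 (x, t)))
    by (intros t; apply Ha; simpl; unfold x, y; lra).
  assert (Hb' : forall t, is_dirichlet_series b (x, t) (g2 (x, t)))
    by (intros t; apply Hb; simpl; unfold x, y; lra).
  assert (Hh1 : forall t, holo_at g1 (x, t)) by (intros t; apply Hg1; unfold C0; simpl; lra).
  assert (Hh2 : forall t, holo_at g2 (x, t)) by (intros t; apply Hg2; unfold C0; simpl; lra).
  assert (M2 : forall lam N0 l, (forall n, (N0 <= n)%nat -> Csum (freq_coef b lam) n = l) ->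
     is_mean (fun t => Cexp (RtoC lam * (x, t)) * g2 (x, t))%C l)
    by (intros lam N0 l; apply (is_mean_dirichlet g2 b lam x B l N0); assumption).
  (* The mean of the identity f1 g1 + f2 g2 = 1 at frequency k ln 3. Here [l] is the coefficient of
     [g2] at 3^k, and [m] the one at 3^(k-1), read as 0 for k = 0. *)
  assert (Hrel : forall k l m N0,
     (forall n, (N0 <= n)%nat -> Csum (freq_coef b (INR k * ln 3)) n = l) ->
     (forall n, (N0 <= n)%nat -> Csum (freq_coef b (INR k * ln 3 - ln 3)) n = m) ->
     (m + RtoC (- / 9) * l)%C = dunit k).
  { intros k l m N0 Hl Hm.
    assert (M1 : is_mean (fun t => Cexp (RtoC (INR k * ln 3 - ln 2) * (x, t)) * g1 (x, t))%C 0).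
    { apply (is_mean_dirichlet g1 a _ x A 0 0); try assumption.
      intros n _. apply Csum_freq_coef_miss. intros j E.
      (* A contribution of f1 g1 would make the odd number 3^k equal to 2 (j + 1). *)
      assert (E' : ln (INR (3 ^ k)) = ln (INR (2 * S j))).
      { rewrite <- ln3_pow, mult_INR, ln_mult by (try (simpl; lra); apply lt_0_INR; lia).
        simpl (INR 2). replace (1 + 1) with 2 by lra. lra. }
      apply ln_inv in E'; [|apply lt_0_INR, pow3_pos|apply lt_0_INR; lia].
      apply INR_eq in E'. assert (O := odd_pow3 k).
      rewrite E', Nat.odd_mul in O. discriminate. }
    assert (S1 := is_mean_plus _ _ _ _ M1 (is_mean_plus _ _ _ _ (M2 _ _ _ Hm)
                    (is_mean_scal (RtoC (- / 9)) _ _ (M2 _ _ _ Hl)))).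
    assert (S2 := is_mean_Cexp (INR k * ln 3) x).
    assert (E : (0 + (m + RtoC (- / 9) * l))%C =
                if Req_EM_T (INR k * ln 3) 0 then RtoC 1 else RtoC 0).
    { apply (is_mean_unique _ _ _ S1). revert S2. apply is_mean_ext. intros t. cbv beta.
      replace (ln 2) with (ln (INR 2)) by (f_equal; simpl; lra).
      replace (INR k * ln 3 - ln 3) with (INR k * ln 3 - ln (INR 3))
        by (rewrite INR_3; reflexivity).
      rewrite !Cexp_shift.
      assert (Ht := H (x, t) ltac:(unfold C0; simpl; lra)).
      unfold corona1, corona2 in Ht. rewrite npow_opp_1 in Ht.
      set (e := Cexp _). transitivity (e * RtoC 1)%C; [ring|]. rewrite <- Ht. ring. }
    assert (A0 : forall z : C, (0 + z = z)%C) by (intros; ring).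
    rewrite A0 in E. rewrite E. assert (L3 := ln3_pos).
    destruct k as [|k]; destruct (Req_EM_T _ 0) as [E0|E0]; try reflexivity.
    - simpl in E0. lra.
    - assert (0 < INR (S k)) by (apply lt_0_INR; lia). nra. }
  assert (Hcoef : forall k, b (3 ^ k)%nat = RtoC (- 9 ^ S k)).
  { assert (L3 := ln3_pos).
    assert (Solve : forall m l e : C,
      (m + RtoC (- / 9) * l = e -> l = RtoC 9 * (m - e))%C).
    { intros m l e <-. rewrite RtoC_opp, RtoC_inv by lra. field. }
    (* The relation gives b_1 = -9 and multiplies by 9 at each step. For k = 0 the lower frequency
       is - ln 3 < 0, which no positive integer attains. *)
    induction k as [|k IH].
    - assert (R0 := Hrel 0%nat (b 1%nat) (RtoC 0) 1%nat (fun n => Csum_freq_coef_pow3 b 0 n)).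
      apply Solve in R0.
      + etransitivity; [exact R0|]. unfold dunit. simpl. apply injective_projections; simpl; ring.
      + intros n _. apply Csum_freq_coef_miss. intros j E.
        assert (L := ln_INR_ge0 j). simpl (INR 0) in E. lra.
    - assert (R1 := Hrel (S k) (b (3 ^ S k)%nat) (b (3 ^ k)%nat) (3 ^ S k)%nat
        (fun n => Csum_freq_coef_pow3 b (S k) n)).
      apply Solve in R1.
      + etransitivity; [exact R1|]. rewrite IH. unfold dunit. simpl. apply injective_projections; simpl; ring.
      + intros n Hn. replace (INR (S k) * ln 3 - ln 3) with (INR k * ln 3)
          by (rewrite S_INR; ring).
        apply Csum_freq_coef_pow3. rewrite Nat.pow_succ_r' in Hn. lia. }
  (* With 3^k >= M, the bound 9^(k+1) <= M 3^k on the line Re s = 1 would give 9 * 3^k <= M <=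
     3^k. *)
  destruct (Pow_x_infinity 3 ltac:(rewrite Rabs_pos_eq; lra) M) as [k Hk].
  specialize (Hk k (Nat.le_refl k)). rewrite Rabs_pos_eq in Hk by (apply pow_le; lra).
  assert (Hfin := mean_bound_shift g2 (INR k * ln 3) 1 x M (b (3 ^ k)%nat) Hg2 HM ltac:(lra)
    (M2 _ _ _ (fun n => Csum_freq_coef_pow3 b k n))).
  rewrite Rmult_1_r, ln3_pow, exp_ln in Hfin by apply lt_0_INR, pow3_pos.
  rewrite Hcoef, Cmod_R, Rabs_Ropp, Rabs_pos_eq in Hfin by (apply pow_le; lra).
  rewrite pow_INR, INR_3 in Hfin. simpl in Hfin.
  replace 9 with (3 * 3) in Hfin by lra. rewrite Rpow_mult_distr in Hfin.
  assert (P : 0 < 3 ^ k) by (apply pow_lt; lra). nra.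
Qed.

Theorem theorem1p4 :
  (forall f : C -> C, Hinf f -> (Hinf_invertible f <-> bounded_below_on_C0 f))
  /\
  (exists (f1 f2 : C -> C) (delta : R),
     Hinf f1 /\ Hinf f2 /\ (0 < delta)%R /\
     (forall s : C, C0 s -> (delta <= Cmod (f1 s) + Cmod (f2 s))%R) /\
     (forall g1 g2 : C -> C, Hinf g1 -> Hinf g2 ->
        ~ (forall s : C, C0 s ->
             Cplus (Cmult (f1 s) (g1 s)) (Cmult (f2 s) (g2 s)) = RtoC 1))).
Proof.
  split; [exact Hinf_invertible_iff|].
  exists corona1, corona2, (/ 16). split; [apply Hinf_scal_npow|].
  split; [apply Hinf_plus; apply Hinf_scal_npow|]. split; [lra|].
  split; [exact corona_bounded_below|exact corona_no_bezout].
Qed.
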